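(* For every real number $d \in (0,2\pi)$ there exists a smooth function $u:\mathbb{R}^2\to\mathbb{R}$ satisfying $\Delta u + e^{2u}\le 0$ on $\mathbb{R}^2$ such that the conformal plane $X^u$ has finite area and $\mathrm{diam}(X^u)=d$.
   Context: For a smooth function $u:\mathbb{R}^2\to\mathbb{R}$, the conformal plane $X^u$ is the Riemannian manifold $(\mathbb{R}^2, e^{2u}\cdot\delta_{Eucl})$, where $\delta_{Eucl}$ is the Euclidean Riemannian metric; it is equipped with the associated Riemannian (length) distance, which need not be complete. Here $\Delta=\partial_x^2+\partial_y^2$ is the Euclidean Laplacian. The area of $X^u$ is $\int_{\mathbb{R}^2}e^{2u}\,d\mathcal{L}^2\in(0,\infty]$, and $\mathrm{diam}(X^u)$ is the supremum of the distances between pairs of points of $X^u$. *)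

(* Defs.v *)
From HB Require Import structures.
From mathcomp Require Import all_boot all_order all_algebra.
From mathcomp Require Import all_classical all_reals all_analysis.

Set Implicit Arguments.
Unset Strict Implicit.
Unset Printing Implicit Defensive.

Import Order.TTheory GRing.Theory Num.Theory.
Import numFieldNormedType.Exports.

Local Open Scope classical_set_scope.
Local Open Scope ring_scope.

Section conformal_plane.
Context {R : realType}.
Implicit Types (u : R * R -> R) (c : R -> R * R) (p q z : R * R).

Definition partial_x u : R * R -> R := fun z => 'D_((1, 0) : R * R) u z.
Definition partial_y u : R * R -> R := fun z => 'D_((0, 1) : R * R) u z.

Definition laplacian u z : R :=
  partial_x (partial_x u) z + partial_y (partial_y u) z.

(* [Ck k u]: all iterated partial derivatives of [u] of order at most [k] exist
   and are continuous. The derivatives of the library are total functions, so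
   existence is required separately. *)
Fixpoint Ck (k : nat) u : Prop :=
  match k with
  | 0 => continuous u
  | k'.+1 => [/\ continuous u,
                 forall z, derivable u z (1, 0) /\ derivable u z (0, 1),
                 Ck k' (partial_x u) & Ck k' (partial_y u)]
  end.

Definition smooth u : Prop := forall k : nat, Ck k u.

Definition C1 (f : R -> R) : Prop :=
  (forall t, derivable f t 1) /\ continuous (derive1 f).

Definition C1_curve c : Prop := C1 (fun t => (c t).1) /\ C1 (fun t => (c t).2).

(* Only the restriction of [c] to [0, 1] matters. A map is C^1 up to the
   endpoints of a compact interval iff it is the restriction of a C^1 map on
   the line. The points of subdivision are 0 followed by [s]; consecutive
   closed pieces share their endpoints, so [c] is continuous on [0, 1]. *)
Definition piecewise_C1 c : Prop :=
  exists2 s : seq R, itv_partition 0 1 s &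
    forall i, (i < size s)%N ->
      exists2 g : R -> R * R, C1_curve g &
        {in `[nth 0 (0 :: s) i, nth 0 s i], c =1 g}.

(* The norm of the product type [R * R] is the sup norm, hence the explicit
   Euclidean norm. *)
Definition speed c (t : R) : R :=
  Num.sqrt (derive1 (fun s => (c s).1) t ^+ 2 + derive1 (fun s => (c s).2) t ^+ 2).

(* Length for the metric [e^(2u) (dx^2 + dy^2)] of the restriction of [c] to
   [0, 1]. The derivative of a piecewise C^1 curve takes an arbitrary value at
   the finitely many points of subdivision, which does not affect the
   integral. *)
Definition conformal_length u c : \bar R :=
  (\int[lebesgue_measure]_(t in `[0%R, 1%R])
     (expR (u (c t)) * speed c t)%:E)%E.

Definition conformal_dist u p q : \bar R :=
  ereal_inf [set conformal_length u c |
             c in [set c | [/\ piecewise_C1 c, c 0 = p & c 1 = q]]].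

Definition conformal_area u : \bar R :=
  (\int[lebesgue_measure \x lebesgue_measure]_z (expR (2 * u z))%:E)%E.

Definition conformal_diam u : \bar R :=
  ereal_sup [set conformal_dist u pq.1 pq.2 | pq in [set: (R * R) * (R * R)]].

End conformal_plane.

(* Main.v *)
Require Import Defs.
From mathcomp Require Import all_boot all_order all_algebra.
From mathcomp Require Import all_classical all_reals all_analysis.
From mathcomp Require Import measurable_realfun ring lra.

Set Implicit Arguments.
Unset Strict Implicit.
Unset Printing Implicit Defensive.

Import Order.TTheory GRing.Theory Num.Theory.
Import numFieldNormedType.Exports.

Local Open Scope classical_set_scope.
Local Open Scope ring_scope.

(** Two curvature 1 footballs with a small cone angle [2 pi al], each of length
    [pi], are glued: the conformal factors of footballs with tips at [(1, 0)]
    and [(-1, 0)] are multiplied, with [|z - p|^2 + eps^2] in place of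
    [|z - p|^2] to smooth the tips. The smoothing only adds curvature, and near
    one tip the other factor is almost constant. A Gaussian factor
    [e^(- del |z|^2)] makes area and diameter finite, and its curvature absorbs
    the interaction of the two factors away from the tips once [al] is small.
    The diameter exceeds [d < 2 pi] because a calibration, built from the polar
    angle of each football and cut off at a distance [rho] from its tip,
    separates the two tips. Shrinking the metric to diameter [d] preserves
    curvature [>= 1]. *)

(** A football is the pull-back of the round metric [2 |dw| / (1 + |w|^2)] under [w = m z^al]. The
    obstacle lies away from both tips: the Laplacian controls [al^2] times the sum of the two
    weights, whereas the exponential contains their product. There this product term is at most
    [al^2 K], with [K] depending only on [m] and [rho], and it is paid for by [4 del] from the
    Gaussian. So [m] must be fixed before [al], although the disc of radius [rho] about a tip has to
    hold almost a whole football for that later [al]. With [m = 1] this fails: as [al] tends to 0,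
    the circle of radius [rho] tends to the equator. Taking [m rho = tan (a / 2)] places it at polar
    angle at least [a], close to [pi], because [rho^al >= rho]. Hence the order of choice: an error
    [eta], then [rho] and [del] proportional to it, then [m], then [al], and last [eps], which keeps
    the smoothed tip at angle at most [eta]. Division by the factor at [neck] makes the influence of
    the far tip at most 1 near a tip, as curvature requires, while it stays at least [k], as length
    requires. *)

(** * Calculus of iterated partial derivatives *)

Section iterated_partials.
Context {R : realType}.
Implicit Types (f g u : R * R -> R) (z v : R * R) (k : nat).

(** Turns a directional derivative into a one-variable derivative along a line, where the chain rule
    [is_derive1_comp] is enough. *)
Lemma is_derive_line f z v d :
  is_derive z v f d <-> is_derive (0 : R) 1 (fun h => f (h *: v + z)) d.
Proof.
have E : (fun h : R => h^-1 *: (f (h *: v + z) - f z)) =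
  (fun h : R => h^-1 *: (f ((h *: 1 + 0) *: v + z) - f (0 *: v + z))).
  by apply/funext => h; rewrite addr0 scale0r add0r /GRing.scale /= mulr1.
by split=> -[e1 e2]; split; move: e1 e2; rewrite /derivable /derive /= E.
Qed.

Lemma is_derive_comp1 f z v d (h : R -> R) e :
  is_derive z v f d -> is_derive (f z) 1 h e ->
  is_derive z v (h \o f) (e * d).
Proof.
move=> /is_derive_line df dh; apply/is_derive_line.
have dh' : is_derive (f ((0 : R) *: v + z)) 1 h e by rewrite scale0r add0r.
exact: (@is_derive1_comp _ h (fun t => f (t *: v + z))).
Qed.

Lemma Ck_continuous k f : Ck k f -> continuous f.
Proof. by case: k => [|k] //= []. Qed.

Lemma CkS k f : Ck k.+1 f -> Ck k f.
Proof.
elim: k f => [f []//|k IH f] [cf df fx fy].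
by split=> //; [exact: IH fx|exact: IH fy].
Qed.

Lemma CkS_derive k f : Ck k.+1 f -> forall z,
  is_derive z (1, 0) f (partial_x f z) /\ is_derive z (0, 1) f (partial_y f z).
Proof. by case=> _ df _ _ z; have [d1 d2] := df z; split; apply: derivableP. Qed.

Lemma Ck_partial k f : Ck k.+1 f -> Ck k (partial_x f) /\ Ck k (partial_y f).
Proof. by case. Qed.

(** Identifies explicit candidate formulas with the total functions [partial_x f] and [partial_y f],
    so that the recursion in [Ck] continues on the formulas. *)
Lemma Ck_build k f f1 f2 : continuous f ->
  (forall z, is_derive z (1, 0) f (f1 z) /\ is_derive z (0, 1) f (f2 z)) ->
  Ck k f1 -> Ck k f2 ->
  Ck k.+1 f /\ partial_x f = f1 /\ partial_y f = f2.
Proof.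
move=> cf df c1 c2.
have E1 : partial_x f = f1.
  by apply/funext => z; have [[_ E] _] := df z.
have E2 : partial_y f = f2.
  by apply/funext => z; have [_ [_ E]] := df z.
split; last by [].
by split; rewrite ?E1 ?E2 // => z; have [[e1 _] [e2 _]] := df z.
Qed.

Lemma Ck_cst k (a : R) : Ck k (fun=> a).
Proof.
elim: k a => [|k IH] a; first exact: cst_continuous.
have [] // := @Ck_build k (fun=> a) (fun=> 0) (fun=> 0); first exact: cst_continuous.
by move=> z; split; exact: is_derive_cst.
Qed.

Lemma is_derive_fst z v : is_derive z v (fun w : R * R => w.1) v.1.
Proof.
apply/is_derive_line => /=.
have d : is_derive (0 : R) 1 (fun h : R => h * v.1 + z.1) (0 *: 0 + v.1 *: 1 + 0).
  by apply: is_deriveD; apply: is_deriveM.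
by apply: is_derive_eq d _; rewrite scale0r add0r addr0 [_ *: _]mulr1.
Qed.

Lemma is_derive_snd z v : is_derive z v (fun w : R * R => w.2) v.2.
Proof.
apply/is_derive_line => /=.
have d : is_derive (0 : R) 1 (fun h : R => h * v.2 + z.2) (0 *: 0 + v.2 *: 1 + 0).
  by apply: is_deriveD; apply: is_deriveM.
by apply: is_derive_eq d _; rewrite scale0r add0r addr0 [_ *: _]mulr1.
Qed.

Lemma Ck_fst k : Ck k (fun z : R * R => z.1).
Proof.
case: k => [|k]; first by move=> z; exact: cvg_fst.
have [] // := @Ck_build k (fun z : R * R => z.1) (fun=> 1) (fun=> 0).
- by move=> z; exact: cvg_fst.
- by move=> z; split; exact: is_derive_fst.
- exact: Ck_cst.
- exact: Ck_cst.
Qed.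

Lemma Ck_snd k : Ck k (fun z : R * R => z.2).
Proof.
case: k => [|k]; first by move=> z; exact: cvg_snd.
have [] // := @Ck_build k (fun z : R * R => z.2) (fun=> 0) (fun=> 1).
- by move=> z; exact: cvg_snd.
- by move=> z; split; exact: is_derive_snd.
- exact: Ck_cst.
- exact: Ck_cst.
Qed.

(** Closure of [Ck k] under sums is a premise, so that one argument serves as the induction step of
    [CkD] and, afterwards, for the formulas of the partials. *)
Lemma CkD_partial k f g : Ck k.+1 f -> Ck k.+1 g ->
  (forall h1 h2 : R * R -> R, Ck k h1 -> Ck k h2 -> Ck k (h1 + h2)) ->
  [/\ Ck k.+1 (f + g), partial_x (f + g) = partial_x f + partial_x g
    & partial_y (f + g) = partial_y f + partial_y g].
Proof.
move=> cf cg IH; have [_ _ f1 f2] := cf; have [_ _ g1 g2] := cg.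
have df := CkS_derive cf; have dg := CkS_derive cg.
have [] // := @Ck_build k (f + g) (partial_x f + partial_x g) (partial_y f + partial_y g).
- by move=> z; apply: continuousD; [exact: Ck_continuous cf _|exact: Ck_continuous cg _].
- move=> z; have [a1 a2] := df z; have [b1 b2] := dg z.
  by split; exact: is_deriveD.
- exact: IH.
- exact: IH.
by move=> ? [].
Qed.

Lemma CkD k f g : Ck k f -> Ck k g -> Ck k (f + g).
Proof.
elim: k f g => [|k IH] f g cf cg; last by have [] := CkD_partial cf cg IH.
by move=> z; apply: continuousD; [exact: cf|exact: cg].
Qed.

Lemma partial_xD k f g : Ck k.+1 f -> Ck k.+1 g ->
  partial_x (f + g) = partial_x f + partial_x g.
Proof. by move=> cf cg; have [] := CkD_partial cf cg (@CkD k). Qed.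

Lemma partial_yD k f g : Ck k.+1 f -> Ck k.+1 g ->
  partial_y (f + g) = partial_y f + partial_y g.
Proof. by move=> cf cg; have [] := CkD_partial cf cg (@CkD k). Qed.

Lemma laplacianD f g z : smooth f -> smooth g ->
  laplacian (f + g) z = laplacian f z + laplacian g z.
Proof.
move=> cf cg; rewrite /laplacian.
rewrite (partial_xD (cf 1%N) (cg 1%N)) (partial_yD (cf 1%N) (cg 1%N)).
have [f1 f2] := Ck_partial (cf 2%N); have [g1 g2] := Ck_partial (cg 2%N).
rewrite (partial_xD f1 g1) (partial_yD f2 g2).
exact: addrACA.
Qed.

Lemma CkM k f g : Ck k f -> Ck k g -> Ck k (f * g).
Proof.
elim: k f g => [|k IH] f g cf cg.
  by move=> z; apply: continuousM; [exact: cf|exact: cg].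
have [_ _ f1 f2] := cf; have [_ _ g1 g2] := cg.
have df := CkS_derive cf; have dg := CkS_derive cg.
have [] // := @Ck_build k (f * g) (f * partial_x g + g * partial_x f)
  (f * partial_y g + g * partial_y f).
- by move=> z; apply: continuousM; [exact: Ck_continuous cf _|exact: Ck_continuous cg _].
- move=> z; have [a1 a2] := df z; have [b1 b2] := dg z.
  by split; exact: is_deriveM.
- by apply: CkD; apply: IH => //; exact: CkS.
- by apply: CkD; apply: IH => //; exact: CkS.
Qed.

(** [P] is a domain where [h] is differentiable, such as the positive half-line for [ln]. The
    premise on [h'] carries the induction: the derivatives of [expR] and of inversion are expressed
    through themselves, and [ln] falls back on inversion. *)
Lemma Ck_comp k (P : pred R) (h h' : R -> R) f :
  (forall z, P (f z)) ->
  (forall t, P t -> is_derive t 1 h (h' t)) ->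
  (Ck k f -> Ck k (h' \o f)) -> Ck k.+1 f -> Ck k.+1 (h \o f).
Proof.
move=> Pf dh IH cf.
have [_ _ f1 f2] := cf; have df := CkS_derive cf; have {}IH := IH (CkS cf).
have [] // := @Ck_build k (h \o f) ((h' \o f) * partial_x f) ((h' \o f) * partial_y f).
- move=> z; apply: continuous_comp; first exact: Ck_continuous cf _.
  apply/differentiable_continuous/derivable1_diffP.
  by have [] := dh _ (Pf z).
- move=> z; have [a1 a2] := df z.
  by split; apply: is_derive_comp1 => //; exact: dh.
- exact: CkM.
- exact: CkM.
Qed.

Lemma Ck_expR k f : Ck k f -> Ck k (expR \o f).
Proof.
elim: k f => [|k IH] f cf.
  by move=> z; apply: continuous_comp; [exact: cf|exact: continuous_expR].
by apply: (@Ck_comp k predT expR expR) => //; exact: IH.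
Qed.

Lemma Ck_inv k f : (forall z, 0 < f z) -> Ck k f -> Ck k (GRing.inv \o f).
Proof.
move=> f0; elim: k f f0 => [|k IH] f f0 cf.
  by move=> z; apply: continuousV; [rewrite gt_eqF|exact: cf].
apply: (@Ck_comp k (fun t => 0 < t) GRing.inv (fun t => - (t^-1 * t^-1))) => //.
  move=> t t0.
  have d : is_derive t 1 (fun x : R => x^-1) (- t ^- 2 *: 1).
    by apply: (@is_deriveV _ id); rewrite gt_eqF.
  by apply: is_derive_eq d _; rewrite [_ *: _]mulr1 expr2 invfM.
move=> cf'.
have -> : (fun t => - (t^-1 * t^-1)) \o f =
  (fun=> -1) * ((GRing.inv \o f) * (GRing.inv \o f)).
  by apply/funext => z; rewrite !fctE /= mulN1r.
by apply: CkM; [exact: Ck_cst|apply: CkM; apply: IH].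
Qed.

Lemma Ck_ln k f : (forall z, 0 < f z) -> Ck k f -> Ck k (@ln R \o f).
Proof.
move=> f0; case: k => [|k] cf.
  by move=> z; apply: continuous_comp; [exact: cf|exact: continuous_ln].
apply: (@Ck_comp k (fun t => 0 < t) (@ln R) GRing.inv) => //.
by move=> cf'; apply: Ck_inv => //; exact: CkS.
Qed.

End iterated_partials.

(** * Calibrations bound lengths from below *)

Section length_lower_bound.
Context {R : realType}.
Implicit Types (u phi P S : R * R -> R) (g c : R -> R * R) (a b t : R).
Local Notation mu := (@lebesgue_measure R).

Definition length_density u c t : R := expR (u (c t)) * speed c t.

(* Differentiability along curves is all that the calibration argument needs,
   and it composes without the theory of differentiable maps on the plane. *)
Definition gradient_along_curves phi P S : Prop :=
  forall g t d1 d2,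
    is_derive t 1 (fun s => (g s).1) d1 -> is_derive t 1 (fun s => (g s).2) d2 ->
    is_derive t 1 (phi \o g) (P (g t) * d1 + S (g t) * d2).

Lemma length_density_ge0 u c t : 0 <= length_density u c t.
Proof. by rewrite mulr_ge0 // ?expR_ge0 // sqrtr_ge0. Qed.

Lemma C1_continuous (f : R -> R) : C1 f -> continuous f.
Proof. by case=> df _ t; apply/differentiable_continuous/derivable1_diffP. Qed.

Lemma C1_curve_continuous g : C1_curve g -> continuous g.
Proof.
case=> /C1_continuous c1 /C1_continuous c2 t.
have -> : g = (fun s => ((g s).1, (g s).2)) by apply/funext => s; case: (g s).
exact: (cvg_pair (c1 t) (c2 t)).
Qed.

Lemma continuous_length_density u g : continuous u -> C1_curve g ->
  continuous (length_density u g).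
Proof.
move=> cu Cg; have cg := C1_curve_continuous Cg.
have [[_ c1] [_ c2]] := Cg.
move=> t; apply: (@continuousM R R (fun s => expR (u (g s))) (speed g)).

  apply: continuous_comp; last exact: continuous_expR.
  by apply: continuous_comp; [exact: cg|exact: cu].
apply: continuous_comp; last exact: sqrt_continuous.
apply: continuousD.
  exact: (continuous_comp (c1 t) (@exprn_continuous R 2 _)).
exact: (continuous_comp (c2 t) (@exprn_continuous R 2 _)).
Qed.

Lemma measurable_continuous_itv (f : R -> R) a b : continuous f ->
  measurable_fun `[a, b] f.
Proof.
move=> cf; apply/measurable_EFinP; apply: (measurable_int mu).
apply: continuous_compact_integrable; first exact: segment_compact.
exact: continuous_subspaceT.
Qed.

(** The interval is open because at an endpoint the derivative of [c] also sees the neighbouring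
    piece. *)
Lemma length_density_eq u g c a b :
  {in `[a, b], c =1 g} -> {in `]a, b[, length_density u c =1 length_density u g}.
Proof.
move=> E t tab.
have nt : \forall s \near t, s \in `]a, b[.
  by apply: near_in_itvoo.
have Ec s : s \in `]a, b[ -> c s = g s by move=> sab; apply/E/subset_itv_oo_cc.
rewrite /length_density /speed Ec // !derive1E.
rewrite (@near_eq_derive _ _ _ (fun s => (c s).1) (fun s => (g s).1)).
  rewrite (@near_eq_derive _ _ _ (fun s => (c s).2) (fun s => (g s).2)) //.
  by near=> s; rewrite Ec //; near: s.
by near=> s; rewrite Ec //; near: s.
Unshelve. all: by end_near. Qed.

Lemma cauchy_schwarz2 (x y x' y' e : R) : 0 <= e -> x ^+ 2 + y ^+ 2 <= e ^+ 2 ->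
  x * x' + y * y' <= e * Num.sqrt (x' ^+ 2 + y' ^+ 2).
Proof.
move=> e0 h; apply: le_trans (ler_norm _) _.
rewrite -sqrtr_sqr -{1}(ger0_norm e0) -sqrtr_sqr -sqrtrM ?sqr_ge0 //.
rewrite ler_sqrt; last by rewrite mulr_ge0 ?sqr_ge0 // addr_ge0 ?sqr_ge0.
apply: (@le_trans _ _ ((x ^+ 2 + y ^+ 2) * (x' ^+ 2 + y' ^+ 2))); last first.
  by rewrite ler_wpM2r // addr_ge0 ?sqr_ge0.
(* Lagrange's identity: the two sides differ by this square. *)
have := sqr_ge0 (x * y' - y * x'); nra.
Qed.

(** The fundamental theorem writes the increment of [phi] as an integral along [g]; Cauchy-Schwarz
    bounds the integrand by the length density. *)
Lemma C1_length_ge u phi P S g a b : continuous u -> continuous P -> continuous S ->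
  gradient_along_curves phi P S ->
  (forall z, P z ^+ 2 + S z ^+ 2 <= expR (u z) ^+ 2) ->
  C1_curve g -> a < b ->
  ((phi (g b) - phi (g a))%:E <= \int[mu]_(t in `[a, b]) (length_density u g t)%:E)%E.
Proof.
move=> cu cP cS dphi bound Cg ab; have cg := C1_curve_continuous Cg.
have [[d1 c1] [d2 c2]] := Cg.
pose D t := P (g t) * derive1 (fun s => (g s).1) t +
  S (g t) * derive1 (fun s => (g s).2) t.
have dF t : is_derive t 1 (phi \o g) (D t).
  by apply: dphi; rewrite derive1E; exact: derivableP.
have cD : continuous D.
  have cPg : continuous (P \o g).
    by move=> t; apply: continuous_comp; [exact: cg|exact: cP].
  have cSg : continuous (S \o g).
    by move=> t; apply: continuous_comp; [exact: cg|exact: cS].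
  move=> t; exact: cvgD (cvgM (cPg t) (c1 t)) (cvgM (cSg t) (c2 t)).
have cF : continuous (phi \o g).
  by move=> t; apply/differentiable_continuous/derivable1_diffP; have [] := dF t.
have <- : (\int[mu]_(t in `[a, b]) (D t)%:E = (phi (g b) - phi (g a))%:E)%E.
  rewrite (@continuous_FTC2 _ D (phi \o g)) //.
  - exact: continuous_subspaceT.
  - split=> [t _||]; first by have [] := dF t.
    + by apply: cvg_at_right_filter; exact: cF.
    + by apply: cvg_at_left_filter; exact: cF.
  - by move=> t _; rewrite derive1E; have [_] := dF t.
apply: le_integral => //.
- by apply: continuous_compact_integrable;
    [exact: segment_compact|exact: continuous_subspaceT].
- apply: continuous_compact_integrable; first exact: segment_compact.
  by apply: continuous_subspaceT; exact: continuous_length_density.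
- move=> t _; rewrite lee_fin; apply: cauchy_schwarz2 => //; exact: expR_ge0.
Qed.

(** Measurability goes through the same induction as the bound, since splitting the integral at a
    subdivision point already requires it. *)
Lemma piecewise_C1_length_ge u phi P S c :
  continuous u -> continuous P -> continuous S ->
  gradient_along_curves phi P S ->
  (forall z, P z ^+ 2 + S z ^+ 2 <= expR (u z) ^+ 2) ->
  piecewise_C1 c ->
  measurable_fun `[0 : R, 1] (length_density u c) /\
  ((phi (c 1) - phi (c 0))%:E <= conformal_length u c)%E.
Proof.
move=> cu cP cS dphi bound [s].
suff H a b : itv_partition a b s ->
  (forall i, (i < size s)%N -> exists2 g, C1_curve g &
     {in `[nth 0 (a :: s) i, nth 0 s i], c =1 g}) ->
  measurable_fun `[a, b] (length_density u c) /\
  ((phi (c b) - phi (c a))%:E <= \int[mu]_(t in `[a, b]) (length_density u c t)%:E)%E.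
  exact: H.
elim: s a => [|x s IH] a [].
  move=> _ /eqP /= <- _; split; first by rewrite set_itv1; exact: measurable_fun_set1.
  rewrite subrr; apply: integral_ge0 => t _.
  by rewrite lee_fin length_density_ge0.
move=> /= /andP[ax sp] /eqP lb pc.
have xb : x <= b.
  rewrite -lb; elim: (s) x sp {lb pc ax IH} => //= y r IHr x /andP[xy /IHr].
  by apply: le_trans; exact: ltW.
have [|i is0|m2 l2] := IH x; first by split => //; exact/eqP.
  by have := pc i.+1; apply.
have [g Cg /= E] := pc 0%N isT.
have E' := length_density_eq u E.
have m1g := @measurable_continuous_itv _ a x (continuous_length_density cu Cg).
have m1go : measurable_fun `]a, x[ (length_density u g).
  by apply: measurable_funS m1g => //; exact: subset_itv_oo_cc.
have m1o : measurable_fun `]a, x[ (length_density u c).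
  apply: eq_measurable_fun m1go => t; rewrite inE /= => /E'.
  by move=> ->.
have m1 := measurable_fun_itv_cc m1o.
have U : `[a, b]%classic = `[a, x] `|` `]x, b].
  by apply: itv_bndbnd_setU; rewrite bnd_simp // ltW.
have m2' : measurable_fun `]x, b] (length_density u c).
  by apply: measurable_funS m2 => //; exact: subset_itv_oc_cc.
have m : measurable_fun `[a, b] (length_density u c).
  by rewrite U; apply/measurable_funU.
split => //.
rewrite U ge0_integral_setU //=; last 3 first.
- by rewrite -U; apply/measurable_EFinP.
- by move=> t _; rewrite lee_fin length_density_ge0.
- by apply/disj_setPS => t [] /=; rewrite !in_itv /= => /andP[_ tx] /andP[]; rewrite ltNge tx.
rewrite integral_itv_obnd_cbnd; last exact/measurable_EFinP.
have -> : phi (c b) - phi (c a) = (phi (c x) - phi (c a)) + (phi (c b) - phi (c x)).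
  by ring.
rewrite EFinD; apply: leeD => //.
rewrite (eq_integral_itv_bounded _ _ m1o m1go E').
have -> : c a = g a by apply: E; rewrite in_itv /= lexx ltW.
have -> : c x = g x by apply: E; rewrite in_itv /= lexx ltW.
exact: C1_length_ge dphi bound Cg ax.
Qed.

Lemma conformal_length_ge u phi P S c :
  continuous u -> continuous P -> continuous S ->
  gradient_along_curves phi P S ->
  (forall z, P z ^+ 2 + S z ^+ 2 <= expR (u z) ^+ 2) ->
  piecewise_C1 c ->
  ((phi (c 1) - phi (c 0))%:E <= conformal_length u c)%E.
Proof.
move=> cu cP cS dphi bound Cc.
by have [] := piecewise_C1_length_ge cu cP cS dphi bound Cc.
Qed.

(** The zero function is a calibration for every [u], and [piecewise_C1_length_ge] then returns
    measurability. *)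
Lemma measurable_length_density u c : continuous u -> piecewise_C1 c ->
  measurable_fun `[0 : R, 1] (length_density u c).
Proof.
move=> cu Cc; have c0 : continuous (fun=> 0 : R) := @cst_continuous (R * R)%type R 0.
suff [] : measurable_fun `[0 : R, 1] (length_density u c) /\
  (((fun=> 0) (c 1) - (fun=> 0) (c 0))%:E <= conformal_length u c)%E by [].
apply: (@piecewise_C1_length_ge u (fun=> 0) _ _ c cu c0 c0 _ _ Cc).
  by move=> g t d1 d2 _ _; rewrite !mul0r addr0; exact: is_derive_cst.
by move=> z; rewrite expr0n addr0 sqr_ge0.
Qed.

End length_lower_bound.

(** * Rescaling; finite diameter and area from Gaussian decay *)

Section scaling_and_finiteness.
Context {R : realType}.
Implicit Types (u : R * R -> R) (c : R -> R * R) (p q z : R * R) (k C s : R).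
Local Notation mu := (@lebesgue_measure R).

Lemma conformal_length_shift u k c : continuous u -> piecewise_C1 c ->
  conformal_length (fun z => u z + k) c = ((expR k)%:E * conformal_length u c)%E.
Proof.
move=> cu Cc; rewrite /conformal_length -ge0_integralZl_EFin ?expR_ge0 //.
- apply: eq_integral => t _.
  by rewrite -EFinM expRD -!mulrA; congr (EFin _); rewrite mulrCA.
- by move=> t _; rewrite lee_fin length_density_ge0.
- by apply/measurable_EFinP; exact: measurable_length_density.
Qed.

Lemma conformal_dist_shift u k p q : continuous u ->
  conformal_dist (fun z => u z + k) p q = ((expR k)%:E * conformal_dist u p q)%E.
Proof.
move=> cu; rewrite /conformal_dist -ereal_inf_pZl ?expR_gt0 // image_comp.
congr ereal_inf; apply: eq_imagel => c [Cc _ _] /=.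
exact: conformal_length_shift.
Qed.

Lemma conformal_diam_shift u k : continuous u ->
  conformal_diam (fun z => u z + k) = ((expR k)%:E * conformal_diam u)%E.
Proof.
move=> cu; rewrite /conformal_diam -ereal_sup_pZl ?expR_gt0 // image_comp.
congr ereal_sup; apply: eq_imagel => pq _ /=.
exact: conformal_dist_shift.
Qed.

Definition segment p q (t : R) : R * R :=
  (p.1 + t * (q.1 - p.1), p.2 + t * (q.2 - p.2)).

Lemma is_derive_affine (a b t : R) : is_derive t 1 (fun t => a + t * b) b.
Proof.
have d : is_derive t 1 (fun t : R => a + t * b) (0 + (t *: 0 + b *: 1)).
  by apply: is_deriveD; apply: is_deriveM.
by apply: is_derive_eq d _; rewrite scaler0 !add0r [_ *: _]mulr1.
Qed.

Lemma derive1_affine (a b : R) : derive1 (fun t : R => a + t * b) = fun=> b.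
Proof. by apply/funext => t; rewrite derive1E; have [_] := is_derive_affine a b t. Qed.

Lemma C1_affine (a b : R) : C1 (fun t : R => a + t * b).
Proof.
split; last by rewrite derive1_affine; exact: cst_continuous.
by move=> t; have [] := is_derive_affine a b t.
Qed.

Lemma piecewise_C1_segment p q : piecewise_C1 (segment p q).
Proof.
exists [:: 1]; first by split => //=; rewrite ltr01.
move=> [|i] //= _; exists (segment p q) => //.
by split; exact: C1_affine.
Qed.

Lemma speed_segment p q t :
  speed (segment p q) t = Num.sqrt ((q.1 - p.1) ^+ 2 + (q.2 - p.2) ^+ 2).
Proof. by rewrite /speed /= !derive1_affine. Qed.

(* Along a line in direction [w] the density is at most [C / (1 + s^2 h^2)],
   with [h] the coordinate along [w], whose primitive is an arctangent. *)
Lemma segment_length_le u C s p q : continuous u -> 0 < C -> 0 < s ->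
  (forall z, expR (u z) <= C * expR (- (s ^+ 2 * (z.1 ^+ 2 + z.2 ^+ 2)))) ->
  (conformal_length u (segment p q) <= (C / s * pi)%:E)%E.
Proof.
move=> cu C0 s0 ub.
pose dx := q.1 - p.1; pose dy := q.2 - p.2.
pose v : R := Num.sqrt (dx ^+ 2 + dy ^+ 2).
have v2 : v ^+ 2 = dx ^+ 2 + dy ^+ 2.
  by rewrite sqr_sqrtr // addr_ge0 ?sqr_ge0.
have v0 : 0 <= v by exact: sqrtr_ge0.
(* The coordinate of [p] along the unit direction of the segment, whose Euclidean length is [v]. *)
pose a : R := (p.1 * dx + p.2 * dy) / v.
pose D (t : R) : R := C * v * (1 + (s * (a + t * v)) ^+ 2)^-1.
pose F (t : R) : R := C / s * atan (s * (a + t * v)).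
have dF (t : R) : is_derive t 1 F (D t).
  have d1 : is_derive t 1 (fun t : R => s * (a + t * v)) (s * v).
    have d : is_derive t 1 (fun t : R => s * (a + t * v)) (s *: v).
      exact: (@is_deriveZ _ _ _ _ s t 1 v (is_derive_affine a v t)).
    exact: d.
  have d2 : is_derive t 1 (atan \o (fun t : R => s * (a + t * v)))
      ((1 + (s * (a + t * v)) ^+ 2)^-1 * (s * v)).
    by apply: is_derive1_comp.
  have d3 : is_derive t 1 F (C / s *: ((1 + (s * (a + t * v)) ^+ 2)^-1 * (s * v))).
    exact: (@is_deriveZ _ _ _ _ (C / s) t 1 _ d2).
  apply: is_derive_eq d3 _; rewrite /D [_ *: _]mulrC.
  by field; rewrite gt_eqF //=; have := sqr_ge0 (s * (a + t * v)); lra.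
have cq : continuous (fun t : R => s * (a + t * v)).
  move=> t; apply: cvgM; first exact: cvg_cst.
  exact: (C1_continuous (C1_affine a v)).
have cD : continuous D.
  move=> t; apply: cvgM; first exact: cvg_cst.
  apply: cvgV; first by have := sqr_ge0 (s * (a + t * v)); lra.
  apply: cvgD; first exact: cvg_cst.
  exact: (continuous_comp (cq t) (@exprn_continuous R 2 _)).
have cF : continuous F.
  by move=> t; apply/differentiable_continuous/derivable1_diffP; have [] := dF t.
have int : (\int[mu]_(t in `[0%R, 1%R]) (D t)%:E = (F 1 - F 0)%:E)%E.
  rewrite (@continuous_FTC2 _ D F) //.
  - exact: continuous_subspaceT.
  - split=> [t _||]; first by have [] := dF t.
    + by apply: cvg_at_right_filter; exact: cF.
    + by apply: cvg_at_left_filter; exact: cF.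
  - by move=> t _; rewrite derive1E; have [_] := dF t.
apply: (@le_trans _ _ (\int[mu]_(t in `[0%R, 1%R]) (D t)%:E)%E).
  have cl : continuous (length_density u (segment p q)).
    by apply: continuous_length_density => //; split; exact: C1_affine.
  apply: le_integral => //.
  - by apply: continuous_compact_integrable;
      [exact: segment_compact|exact: continuous_subspaceT].
  - by apply: continuous_compact_integrable;
      [exact: segment_compact|exact: continuous_subspaceT].
  move=> t _; rewrite lee_fin speed_segment -/dx -/dy -/v /D.
  rewrite -mulrA [v * _]mulrC mulrA ler_wpM2r //.
  apply: le_trans (ub _) _; rewrite ler_wpM2l ?(ltW C0) //.
  set r2 := _ + _.
  have ineq : (a + t * v) ^+ 2 <= r2.
    (* For [p = q], division by [v = 0] returns [a = 0] and the claim is [0 <= r2]. Otherwise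
       [a + t * v] is the projection of the point to a unit direction. *)
    have [vz|vn] := eqVneq v 0.
      by rewrite /a vz invr0 !mulr0 addr0 expr0n /= /r2 addr_ge0 ?sqr_ge0.
    have -> : a + t * v = ((segment p q t).1 * dx + (segment p q t).2 * dy) / v.
      rewrite /a /segment /= -/dx -/dy; apply: (mulIf vn).
      rewrite mulrDl !divfK // -mulrA -expr2 v2; ring.
    rewrite expr_div_n ler_pdivrMr; last by rewrite exprn_gt0 // lt_neqAle eq_sym vn.
    rewrite v2 /r2; set g := segment p q t.
    have := sqr_ge0 (g.1 * dy - g.2 * dx); nra.
  have r20 : 0 <= r2 by apply: le_trans ineq; exact: sqr_ge0.
  rewrite expRN.
  rewrite lef_pV2 ?posrE ?expR_gt0 //; last first.
    by have := sqr_ge0 (s * (a + t * v)); lra.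
  apply: le_trans (expR_ge1Dx _).
  by rewrite lerD2l exprMn ler_wpM2l ?sqr_ge0.
rewrite int lee_fin /F -mulrBr ler_wpM2l ?divr_ge0 ?(ltW C0) ?(ltW s0) //.
have := atan_ltpi2 (s * (a + 1 * v)); have := atan_gtNpi2 (s * (a + 0 * v)).
lra.
Qed.

Lemma conformal_diam_lty u C s : continuous u -> 0 < C -> 0 < s ->
  (forall z, expR (u z) <= C * expR (- (s ^+ 2 * (z.1 ^+ 2 + z.2 ^+ 2)))) ->
  (conformal_diam u < +oo)%E.
Proof.
move=> cu C0 s0 ub; apply: (@le_lt_trans _ _ (C / s * pi)%:E); last exact: ltry.
apply: ge_ereal_sup => _ [[p q] _ <-] /=.
apply: le_trans (segment_length_le p q cu C0 s0 ub).
apply: ereal_inf_lbound; exists (segment p q) => //; split.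
- exact: piecewise_C1_segment.
- by rewrite /segment !mul0r !addr0; case: p.
- by rewrite /segment !mul1r !subrKC; case: q.
Qed.

Lemma gauss_integral_lty (s : R) : 0 < s ->
  (\int[mu]_x (expR (- (s * x) ^+ 2))%:E < +oo)%E.
Proof.
(* With this standard deviation [2 sg^2 = s^-2], so the integrand is a multiple of a centred normal
   density. *)
move=> s0; pose sg := (Num.sqrt 2 * s)^-1.
have sg0 : sg != 0 by rewrite invr_neq0 // mulf_neq0 ?gt_eqF // sqrtr_gt0.
have sg2 : sg ^+ 2 *+ 2 = (s ^+ 2)^-1.
  rewrite /sg exprVn exprMn sqr_sqrtr // -mulr_natr; field.
  by rewrite gt_eqF.
have E x : expR (- (s * x) ^+ 2) = (normal_peak sg)^-1 * normal_pdf 0 sg x.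
  rewrite /normal_pdf (negbTE sg0) mulrA mulVf ?mul1r; last first.
    by rewrite gt_eqF // normal_peak_gt0.
  rewrite /normal_fun subr0; congr expR.
  rewrite sg2 invrK exprMn; ring.
under eq_integral do rewrite E EFinM.
rewrite ge0_integralZl_EFin ?invr_ge0 ?normal_peak_ge0 //.
- by rewrite integral_normal_pdf mule1 ltry.
- by move=> x _; rewrite lee_fin normal_pdf_ge0.
- by apply/measurable_EFinP; exact: measurable_normal_pdf.
Qed.

Lemma conformal_area_lty u C s : measurable_fun setT u -> 0 < C -> 0 < s ->
  (forall z, expR (u z) <= C * expR (- (s ^+ 2 * (z.1 ^+ 2 + z.2 ^+ 2)))) ->
  (conformal_area u < +oo)%E.
Proof.
move=> mu' C0 s0 ub.
(* Squaring the bound on [expR u] doubles the exponent. Half of that decay is given up; the rest is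
   a product of one-variable functions, ready for Tonelli. *)
pose G (z : R * R) := C ^+ 2 * (expR (- (s * z.1) ^+ 2) * expR (- (s * z.2) ^+ 2)).
have mG1 : measurable_fun setT (fun x : R => expR (- (s * x) ^+ 2)).
  apply: measurableT_comp => //; apply: measurableT_comp => //.
  by apply: measurable_funX; exact: measurable_funM.
have mG : measurable_fun setT G.
  apply: measurable_funM => //; apply: measurable_funM.
    exact: (measurableT_comp mG1 measurable_fst).
  exact: (measurableT_comp mG1 measurable_snd).
apply: (@le_lt_trans _ _ (\int[mu \x mu]_z (G z)%:E)%E).
  apply: ge0_le_integral => //.
  - apply/measurable_EFinP; apply: measurableT_comp => //.
    exact: measurable_funM.
  - by apply/measurable_EFinP.
  move=> z _; rewrite lee_fin expRM_natl /G -expRD.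
  apply: (@le_trans _ _ ((C * expR (- (s ^+ 2 * (z.1 ^+ 2 + z.2 ^+ 2)))) ^+ 2)).
    by rewrite lerXn2r ?nnegrE ?expR_ge0 // mulr_ge0 ?expR_ge0 ?(ltW C0).
  rewrite exprMn ler_wpM2l ?sqr_ge0 // -expRM_natl ler_expR !exprMn.
  by have := mulr_ge0 (sqr_ge0 s) (addr_ge0 (sqr_ge0 z.1) (sqr_ge0 z.2)); lra.
rewrite fubini_tonelli1 //; last 2 first.
- by apply/measurable_EFinP.
- by move=> z; rewrite lee_fin; apply: mulr_ge0; [exact: sqr_ge0|rewrite mulr_ge0 ?expR_ge0].
pose I := (\int[mu]_x (expR (- (s * x) ^+ 2))%:E)%E.
have I0 : (0 <= I)%E by apply: integral_ge0 => x _; rewrite lee_fin expR_ge0.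
have If : I \is a fin_num by rewrite ge0_fin_numE // gauss_integral_lty.
have in1 x : fubini_F mu (fun z => (G z)%:E) x = ((C ^+ 2 * fine I)%:E * (expR (- (s * x) ^+ 2))%:E)%E.
  rewrite /fubini_F /G /=.
  under eq_integral do rewrite mulrA EFinM.
  rewrite ge0_integralZl_EFin //.
  - by rewrite -/I -(fineK If) /= -!EFinM; congr EFin; ring.
  - by apply/measurable_EFinP.
  - by rewrite mulr_ge0 ?expR_ge0 ?sqr_ge0.
rewrite [ltLHS](_ : _ = \int[mu]_x ((C ^+ 2 * fine I)%:E * (expR (- (s * x) ^+ 2))%:E)%E)%E; last first.
  by apply: eq_integral => x _; exact: in1.
rewrite ge0_integralZl_EFin //.
- by rewrite -/I -(fineK If) -EFinM ltry.
- by apply/measurable_EFinP.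
- by rewrite mulr_ge0 ?sqr_ge0 // fine_ge0.
Qed.

End scaling_and_finiteness.

(** * Radial functions and their Laplacian *)

Section radial_functions.
Context {R : realType} (eps : R).
Implicit Types (a : R) (z v : R * R) (F : R -> R).

Definition sqdist a z : R := (z.1 - a) ^+ 2 + z.2 ^+ 2 + eps ^+ 2.

Lemma smooth_sqdist a : smooth (sqdist a).
Proof.
have -> : sqdist a = (((fun z => z.1) + (fun=> - a)) * ((fun z => z.1) + (fun=> - a))
    + (fun z => z.2) * (fun z => z.2)) + (fun=> eps ^+ 2).
  by apply/funext => z; rewrite /sqdist !expr2.
by move=> k; repeat first [apply: CkD | apply: CkM | exact: Ck_fst | exact: Ck_snd | exact: Ck_cst].
Qed.

Lemma is_derive_sqdist a z v :
  is_derive z v (sqdist a) (2 * (z.1 - a) * v.1 + 2 * z.2 * v.2).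
Proof.
have -> : sqdist a = (((fun z => z.1) + (fun=> - a)) * ((fun z => z.1) + (fun=> - a))
    + (fun z => z.2) * (fun z => z.2)) + (fun=> eps ^+ 2).
  by apply/funext => w; rewrite /sqdist !expr2.
have d1 := is_derive_fst z v; have d2 := is_derive_snd z v.
have d3 : is_derive z v (fun=> - a) 0 by exact: is_derive_cst.
have d4 : is_derive z v (fun=> eps ^+ 2) 0 by exact: is_derive_cst.
have d5 := is_deriveD d1 d3.
apply: is_derive_eq (is_deriveD (is_deriveD (is_deriveM d5 d5) (is_deriveM d2 d2)) d4) _.
by rewrite /GRing.scale /= !fctE; ring.
Qed.

Lemma is_derive_radial F (F1 : R -> R) a z v :
  is_derive (sqdist a z) 1 F (F1 (sqdist a z)) ->
  is_derive z v (F \o sqdist a)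
    (F1 (sqdist a z) * (2 * (z.1 - a) * v.1 + 2 * z.2 * v.2)).
Proof. by apply: is_derive_comp1; exact: is_derive_sqdist. Qed.

Lemma sqdist_gt0 a z : 0 < eps -> 0 < sqdist a z.
Proof.
by move=> e0; rewrite ltr_wpDl ?exprn_gt0 // addr_ge0 ?sqr_ge0.
Qed.

(** The function [Q = sqdist a] has Laplacian 4 and squared gradient [4 (Q - eps^2)], whence the two
    coefficients. *)
Lemma laplacian_radial F (F1 F2 : R -> R) a z : 0 < eps ->
  (forall q : R, 0 < q -> is_derive q 1 F (F1 q)) ->
  (forall q : R, 0 < q -> is_derive q 1 F1 (F2 q)) ->
  laplacian (F \o sqdist a) z =
  4 * F1 (sqdist a z) + 4 * (sqdist a z - eps ^+ 2) * F2 (sqdist a z).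
Proof.
move=> e0 dF dF1; have q0 w := sqdist_gt0 a w e0.
have Ex : partial_x (F \o sqdist a) =
    (F1 \o sqdist a) * (((fun=> 2) * (fun w : R * R => w.1)) + (fun=> - (2 * a))).
  apply/funext => w; have [_] := is_derive_radial (1, 0) (dF _ (q0 w)).
  by rewrite /partial_x => ->; rewrite !fctE /=; ring.
have Ey : partial_y (F \o sqdist a) =
    (F1 \o sqdist a) * ((fun=> 2) * (fun w : R * R => w.2)).
  apply/funext => w; have [_] := is_derive_radial (0, 1) (dF _ (q0 w)).
  by rewrite /partial_y => ->; rewrite !fctE /=; ring.
have dc v (k : R) : is_derive z v (fun=> k) 0 by exact: is_derive_cst.
have d1 v := is_derive_fst z v; have d2 v := is_derive_snd z v.
have dr v := is_derive_radial v (dF1 _ (q0 z)).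
rewrite /laplacian Ex Ey.
have [_ X] := is_deriveM (dr (1, 0)) (is_deriveD (is_deriveM (dc (1, 0) 2) (d1 (1, 0)))
  (dc (1, 0) (- (2 * a)))).
have [_ Y] := is_deriveM (dr (0, 1)) (is_deriveM (dc (0, 1) 2) (d2 (0, 1))).
rewrite {1}/partial_x X /partial_y Y /GRing.scale /= !fctE /=.
set f1 := F1 _; set f2 := F2 _; rewrite /sqdist; ring.
Qed.

End radial_functions.

(** * The football of curvature 1 *)

Section profile.
Context {R : realType} (al m : R).
Hypotheses (al_gt0 : 0 < al) (al_le : al <= 1 / 2) (m_gt0 : 0 < m).
Implicit Types q : R.

(* The metric [2 al m e^(profile (|z|^2)) |dz|] is the football of curvature 1
   with two cone points of angle [2 pi al], at 0 and infinity. *)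
Definition pull q : R := m ^+ 2 * expR (al * ln q).
Definition profile q : R := - ((1 - al) / 2 * ln q) - ln (1 + pull q).
Definition profile1 q : R :=
  - ((1 - al) / 2 + al * (pull q / (1 + pull q))) / q.
Definition profile2 q : R :=
  ((1 - al) / 2 + al * (pull q / (1 + pull q))
   - al ^+ 2 * (pull q / (1 + pull q) ^+ 2)) / q ^+ 2.
(** [al ^+ 2 * weight q] is the square of the conformal factor [2 al m e^(profile q)]; here [pull q]
    is [|w|^2] for [w = m z^al]. *)
Definition weight q : R := 4 * pull q / (q * (1 + pull q) ^+ 2).

Lemma pull_gt0 q : 0 < pull q.
Proof. by rewrite mulr_gt0 ?expR_gt0 // exprn_gt0. Qed.

Lemma pull1_gt0 q : 0 < 1 + pull q.
Proof. by rewrite addr_gt0 // pull_gt0. Qed.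

Lemma pull1_neq0 q : 1 + pull q != 0.
Proof. by rewrite gt_eqF // pull1_gt0. Qed.

Lemma is_derive_pull q : 0 < q -> is_derive q 1 pull (al * pull q / q).
Proof.
move=> q0; have d0 := is_derive1_ln q0.
have d1 : is_derive q 1 (fun x => al * ln x) (al * q^-1).
  exact: (@is_deriveZ _ _ _ _ al q 1 _ d0).
have d2 := @is_derive1_comp _ expR (fun x => al * ln x) q _ _ (is_derive_expR _) d1.
apply: is_derive_eq (@is_deriveZ _ _ _ _ (m ^+ 2) q 1 _ d2) _.
by rewrite /GRing.scale /= /pull; ring.
Qed.

Lemma is_derive_profile q : 0 < q -> is_derive q 1 profile (profile1 q).
Proof.
move=> q0; have d0 := is_derive1_ln q0; have dp := is_derive_pull q0.
have d1 : is_derive q 1 (fun x => 1 + pull x) (0 + al * pull q / q).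
  by apply: is_deriveD.
have d2 := @is_derive1_comp _ (@ln R) _ q _ _ (is_derive1_ln (pull1_gt0 q)) d1.
have d3 := @is_deriveN _ _ _ _ _ _ _ (@is_deriveZ _ _ _ _ ((1 - al) / 2) q 1 _ d0).
apply: is_derive_eq (is_deriveB d3 d2) _.
rewrite /GRing.scale /= /profile1; field.
by rewrite pull1_neq0 gt_eqF.
Qed.

Lemma is_derive_profile1 q : 0 < q -> is_derive q 1 profile1 (profile2 q).
Proof.
move=> q0; have dp := is_derive_pull q0.
have dc (k : R) : is_derive q 1 (fun=> k) 0 by exact: is_derive_cst.
have d1 : is_derive q 1 (fun x => 1 + pull x) (0 + al * pull q / q).
  by apply: is_deriveD.
have d2 := is_deriveM dp (@is_deriveV R (fun x => 1 + pull x) q _ _ (pull1_neq0 q) d1).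
have d3 := @is_deriveZ _ _ _ _ al q 1 _ d2.
have d4 : is_derive q 1 (fun x => - ((1 - al) / 2 + al * (pull x / (1 + pull x))))
    (- (0 + al * (pull q * (- (1 + pull q) ^- 2 * (0 + al * pull q / q)) +
                  (1 + pull q)^-1 * (al * pull q / q)))).
  exact: (is_deriveN (is_deriveD (dc ((1 - al) / 2)) d3)).
have d5 : is_derive q 1 (fun x : R => x^-1) (- q ^- 2 *: 1).
  by apply: (@is_deriveV _ id); rewrite gt_eqF.
apply: is_derive_eq (is_deriveM d4 d5) _.
rewrite /GRing.scale /= /profile2; field.
by rewrite pull1_neq0 gt_eqF.
Qed.

Lemma expR_profile q : 0 < q -> 4 * m ^+ 2 * expR (2 * profile q) = weight q.
Proof.
move=> q0.
have -> : 2 * profile q = al * ln q - ln q - ln (1 + pull q) - ln (1 + pull q).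
  by rewrite /profile; field.
rewrite !expRD !expRN !lnK ?posrE ?pull1_gt0 // /weight {3}/pull; field.
by rewrite pull1_neq0 gt_eqF.
Qed.

Lemma weight_gt0 q : 0 < q -> 0 < weight q.
Proof.
by move=> q0; rewrite divr_gt0 // mulr_gt0 // ?pull_gt0 ?exprn_gt0 ?pull1_gt0.
Qed.

Lemma weight_le q : 0 < q -> weight q <= q^-1.
Proof.
move=> q0; rewrite /weight ler_pdivrMr; last by rewrite mulr_gt0 // exprn_gt0 // pull1_gt0.
rewrite mulKf ?gt_eqF //.
by have := sqr_ge0 (1 - pull q); lra.
Qed.

(** For [e = 0] this is Liouville's equation, with equality. For [q = |z - p|^2 + e] the surplus is
    [4 * e * profile2 q], and [profile2] is nonnegative because [(1 - al) / 2 >= 1 / 4 >= al^2]. *)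
Lemma profile_curvature q e : 0 < q -> 0 <= e ->
  al ^+ 2 * weight q <= - (4 * profile1 q + 4 * (q - e) * profile2 q).
Proof.
move=> q0 e0; rewrite -subr_ge0.
have p0 := pull_gt0 q; have p1 := pull1_gt0 q.
set w := pull q / (1 + pull q).
have w0 : 0 <= w by rewrite divr_ge0 ?ltW.
have w1 : w <= 1 by rewrite ler_pdivrMr //; lra.
have -> : - (4 * profile1 q + 4 * (q - e) * profile2 q) - al ^+ 2 * weight q =
    4 * e / q ^+ 2 * ((1 - al) / 2 + al * w - al ^+ 2 * (w * (1 - w))).
  rewrite /profile1 /profile2 /weight /w; field.
  by rewrite pull1_neq0 gt_eqF.
apply: mulr_ge0; first by rewrite divr_ge0 ?sqr_ge0 // mulr_ge0.
have x1 : w * (1 - w) <= 1 by have := mulr_ge0 w0 w0; lra.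
have : al ^+ 2 * (w * (1 - w)) <= al ^+ 2 by rewrite ler_piMr ?sqr_ge0.
have := al_le; have := al_gt0 => a0 a1.
have : 0 <= (1 / 2 - al) * (1 / 2 + al) by apply: mulr_ge0; lra.
have := mulr_ge0 (ltW al_gt0) w0; lra.
Qed.

Lemma pull_le p q : 0 < p -> p <= q -> pull p <= pull q.
Proof.
move=> p0 pq; rewrite ler_wpM2l ?sqr_ge0 // ler_expR ler_wpM2l ?(ltW al_gt0) //.
by rewrite ler_ln ?posrE // (lt_le_trans p0).
Qed.

Lemma profile_le p q : 0 < p -> p <= q -> profile q <= profile p.
Proof.
move=> p0 pq; have q0 := lt_le_trans p0 pq.
have := al_le; have := al_gt0 => a0 a1.
have h1 : ln p <= ln q by rewrite ler_ln ?posrE.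
have h2 : ln (1 + pull p) <= ln (1 + pull q).
  by rewrite ler_ln ?posrE ?pull1_gt0 // lerD2l pull_le.
rewrite /profile; nra.
Qed.

(** As a function of [ln q] the profile has slope at least [-(1 + al) / 2], hence at least -1. This
    limits how far the factor of one tip can fall across a disc around the other. *)
Lemma profile_ge p q : 0 < p -> p <= q -> ln p - ln q <= profile q - profile p.
Proof.
move=> p0 pq; have q0 := lt_le_trans p0 pq.
have := al_le; have := al_gt0 => a0 a1.
have h1 : ln p <= ln q by rewrite ler_ln ?posrE.
have h2 : ln (1 + pull q) <= al * (ln q - ln p) + ln (1 + pull p).
  rewrite -ler_expR expRD !lnK ?posrE ?pull1_gt0 //.
  have -> : pull q = expR (al * (ln q - ln p)) * pull p.
    by rewrite /pull mulrCA -expRD; congr (_ * expR _); ring.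
  have x1 : 1 <= expR (al * (ln q - ln p)).
    by rewrite -expR0 ler_expR mulr_ge0 ?(ltW a0) // subr_ge0.
  by rewrite [leRHS]mulrDr mulr1 lerD2r.
rewrite /profile; nra.
Qed.

(** The polar angle [2 atan |w|] of the round sphere at [w = m z^al], [q = |z|^2]: the distance to
    the tip in the football. *)
Definition angle q : R := 2 * atan (m * expR (al / 2 * ln q)).
Definition angle1 q : R := al * (m * expR (al / 2 * ln q)) / (q * (1 + pull q)).

Lemma pull_half q : (m * expR (al / 2 * ln q)) ^+ 2 = pull q.
Proof.
by rewrite exprMn /pull -expRM_natl; congr (_ * expR _); lra.
Qed.

Lemma is_derive_angle q : 0 < q -> is_derive q 1 angle (angle1 q).
Proof.
move=> q0; have d0 := is_derive1_ln q0.
have d1 : is_derive q 1 (fun x => al / 2 * ln x) (al / 2 * q^-1).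
  exact: (@is_deriveZ _ _ _ _ (al / 2) q 1 _ d0).
have d2 := @is_derive1_comp _ expR _ q _ _ (is_derive_expR _) d1.
have d3 : is_derive q 1 (fun x => m * expR (al / 2 * ln x))
    (m * (expR (al / 2 * ln q) * (al / 2 * q^-1))).
  exact: (@is_deriveZ _ _ _ _ m q 1 _ d2).
have d4 := @is_derive1_comp _ (@atan R) _ q _ _ (is_derive1_atan _) d3.
apply: is_derive_eq (@is_deriveZ _ _ _ _ 2 q 1 _ d4) _.
rewrite /GRing.scale /= /angle1 pull_half; field.
by rewrite pull1_neq0 gt_eqF.
Qed.

(** The angle is a distance function of the football, so equality holds for [r2 = q]; smoothing the
    tip only lowers [r2] below [q]. *)
Lemma angle1_le q r2 : 0 < q -> r2 <= q ->
  4 * r2 * angle1 q ^+ 2 <= al ^+ 2 * weight q.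
Proof.
move=> q0 rq.
have -> : al ^+ 2 * weight q = 4 * q * angle1 q ^+ 2.
  rewrite /angle1 !exprMn exprVn -exprMn pull_half /weight; field.
  by rewrite pull1_neq0 gt_eqF.
by rewrite ler_wpM2r ?sqr_ge0 // ler_wpM2l.
Qed.

End profile.

(** * A cutoff of class C^1 *)

Section cutoff.
Context {R : realType}.
Implicit Types (t a b : R).

Definition pos2 t : R := Num.max t 0 ^+ 2.

Lemma is_derive_pos2 t : is_derive t 1 pos2 (2 * Num.max t 0).
Proof.
have [t0|t0|->] := ltgtP t 0.
- rewrite mulr0; apply: (@near_eq_is_derive _ _ _ (fun=> 0)).
    near=> x; rewrite /pos2 max_r ?expr0n //= ltW //.
    by near: x; exact: lt_nbhsl.
- have d : is_derive t 1 (fun x : R => x ^+ 2) (2 * t).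
    have d1 : is_derive t 1 (id ^+ 2 : R -> R) ((2%:R * t ^+ 1) *: 1).
      exact: (@is_deriveX _ _ id 2 t 1 1).
    by apply: is_derive_eq d1 _; rewrite [_ *: _]mulr1 expr1.
  apply: near_eq_is_derive d; near=> x; rewrite /pos2 max_l // ltW //.
  by near: x; exact: lt_nbhsr.
- rewrite ?maxxx mulr0.
  (* At 0 the difference quotient of [pos2] is at most [|h|] in absolute value. *)
  have L : h^-1 *: (pos2 (h *: 1 + 0) - pos2 0) @[h --> (0 : R)^'] --> (0 : R).
    apply/cvgr0Pnorm_le => e e0; near=> h.
    rewrite addr0 [_ *: 1]mulr1 {2}/pos2 maxxx expr0n subr0 /pos2 normrZ normfV.
    have h0 : 0 < `|h| by rewrite normr_gt0; near: h; exact: nbhs_dnbhs_neq.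
    rewrite mulrC ler_pdivrMr // normrX.
    have hm : `|Num.max h 0| <= `|h|.
      by case: (leP h 0) => // _; rewrite normr0.
    have he : `|h| <= e.
      near: h; apply: dnbhs0_le => //.
    by rewrite expr2 ler_pM // (le_trans hm).
  split; first by apply/cvg_ex; exists 0.
  exact: cvg_lim L.
Unshelve. all: by end_near. Qed.

(** The primitive, zero beyond [a], of a ramp equal to 1 up to [b] and falling linearly to 0 at [a].
    A quadratic spline is enough, as calibrations only need a continuous gradient. *)
Definition cutoff a b t : R := (pos2 (b - t) - pos2 (a - t)) / (2 * (a - b)).
Definition cutoff1 a b t : R := (Num.max (a - t) 0 - Num.max (b - t) 0) / (a - b).

Lemma is_derive_cutoff a b t : b < a -> is_derive t 1 (cutoff a b) (cutoff1 a b t).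
Proof.
move=> ab.
have d c : is_derive t 1 (fun x => pos2 (c - x)) (2 * Num.max (c - t) 0 * -1).
  have d0 : is_derive t 1 (fun x : R => c - x) (-1).
    have d1 : is_derive t 1 (fun x : R => c - x) (0 - 1) by apply: is_deriveB.
    by rewrite sub0r in d1.
  exact: (@is_derive1_comp _ pos2 _ t _ _ (is_derive_pos2 _) d0).
have d2 := @is_deriveZ _ _ _ _ (2 * (a - b))^-1 t 1 _ (is_deriveB (d b) (d a)).
have -> : cutoff a b =
    (2 * (a - b))^-1 \*: ((fun x => pos2 (b - x)) - (fun x => pos2 (a - x))).
  by apply/funext => x; rewrite /cutoff mulrC.
apply: is_derive_eq d2 _; rewrite /cutoff1 /GRing.scale /=; field.
by rewrite subr_eq0 gt_eqF.
Qed.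

Lemma continuous_cutoff1 a b : continuous (cutoff1 a b).
Proof.
have c d : continuous (fun t : R => Num.max (d - t) 0).
  move=> t; apply: (@continuous_max _ _ (fun t => d - t) (fun=> 0)).
    by apply: cvgB; [exact: cvg_cst|exact: cvg_id].
  exact: cvg_cst.
by move=> t; apply: cvgM; [apply: cvgB; exact: c|exact: cvg_cst].
Qed.

Lemma cutoff1_ge0 a b t : b < a -> 0 <= cutoff1 a b t.
Proof.
move=> ab; rewrite divr_ge0 ?subr_ge0 ?(ltW ab) //.
by case: (leP (a - t) 0); case: (leP (b - t) 0); lra.
Qed.

Lemma cutoff1_le1 a b t : b < a -> cutoff1 a b t <= 1.
Proof.
move=> ab; rewrite ler_pdivrMr ?subr_gt0 // mul1r.
by case: (leP (a - t) 0); case: (leP (b - t) 0); lra.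
Qed.

Lemma cutoff1_eq0 a b t : b < a -> a <= t -> cutoff1 a b t = 0.
Proof. by move=> ab at_; rewrite /cutoff1 !max_r ?subrr ?mul0r // subr_le0 //; lra. Qed.

Lemma cutoff_eq0 a b t : b < a -> a <= t -> cutoff a b t = 0.
Proof.
by move=> ab at_; rewrite /cutoff /pos2 !max_r ?subrr ?mul0r // subr_le0 //; lra.
Qed.

Lemma cutoff_below a b t : b < a -> t <= b -> cutoff a b t = t - (a + b) / 2.
Proof.
move=> ab tb; rewrite /cutoff /pos2 !max_l ?subr_ge0 //; last by lra.
by field; rewrite subr_eq0 gt_eqF.
Qed.

End cutoff.

(** * The glued metric and its curvature *)

Section glued_footballs.
Context {R : realType} (al m eps rho del : R).
Hypotheses (al_gt0 : 0 < al) (al_le : al <= 1 / 2) (m_gt0 : 0 < m).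
Hypotheses (eps_gt0 : 0 < eps) (rho_gt0 : 0 < rho) (rho_le1 : rho <= 1).
Hypothesis del_gt0 : 0 < del.
Implicit Types (a : R) (z : R * R).
Local Notation Q := (sqdist eps).
Local Notation P := (profile al m).
Local Notation W := (weight al m).

(** The least squared distance to one tip from the disc of radius [rho] about the other, the tips
    being 2 apart. *)
Definition neck : R := (2 - rho) ^+ 2.

(** At [q = Q 0 z] the terms in [del] add up to [- del |z|^2]; passing through [Q 0] makes
    [laplacian_radial] applicable. *)
Definition gauss_part (q : R) : R :=
  ln (2 * al * m) - P neck + del * eps ^+ 2 - del * q.

(* Near each tip [(a, 0)], [a = +-1], the factor coming from the other tip is
   close to [expR (profile neck)], so [u0] is close to the conformal factor of a
   single football; the Gaussian term makes the total area finite. *)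
Definition u0 : R * R -> R := (P \o Q 1) + (P \o Q (-1)) + (gauss_part \o Q 0).

Lemma u0E z : u0 z = ln (2 * al * m) - P neck + P (Q 1 z) + P (Q (-1) z)
  - del * (z.1 ^+ 2 + z.2 ^+ 2).
Proof. by rewrite /u0 !fctE /= /gauss_part /sqdist; ring. Qed.

Lemma sqdist_pos a z : 0 < Q a z.
Proof. exact: sqdist_gt0. Qed.

Lemma smooth_profile_sqdist a : smooth (P \o Q a).
Proof.
move=> k; have cL : Ck k (@ln R \o Q a).
  by apply: Ck_ln; [exact: sqdist_pos|exact: smooth_sqdist].
have -> : P \o Q a = (fun=> - ((1 - al) / 2)) * (@ln R \o Q a) + (fun=> -1) *
    (@ln R \o ((fun=> 1) + (fun=> m ^+ 2) * (expR \o ((fun=> al) * (@ln R \o Q a))))).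
  by apply/funext => z; rewrite /= /profile /pull !fctE /=; ring.
apply: CkD; apply: CkM => //; try exact: Ck_cst.
apply: Ck_ln; first by move=> z; exact: pull1_gt0.
apply: CkD; first exact: Ck_cst.
apply: CkM; first exact: Ck_cst.
by apply: Ck_expR; apply: CkM => //; exact: Ck_cst.
Qed.

Lemma smooth_gauss_part : smooth (gauss_part \o Q 0).
Proof.
move=> k.
have -> : gauss_part \o Q 0 =
    (fun=> ln (2 * al * m) - P neck + del * eps ^+ 2) + (fun=> - del) * Q 0.
  by apply/funext => z; rewrite /gauss_part !fctE /= mulNr.
apply: CkD; first exact: Ck_cst.
by apply: CkM; [exact: Ck_cst|exact: smooth_sqdist].
Qed.

Lemma smooth_u0 : smooth u0.
Proof.
move=> k; apply: CkD; last exact: smooth_gauss_part.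
by apply: CkD; exact: smooth_profile_sqdist.
Qed.

Lemma laplacian_u0_le z :
  laplacian u0 z <= - (al ^+ 2 * W (Q 1 z)) - al ^+ 2 * W (Q (-1) z) - 4 * del.
Proof.
have sP a := smooth_profile_sqdist a.
rewrite /u0 laplacianD; last 2 first.
- by move=> k; apply: CkD; exact: sP.
- exact: smooth_gauss_part.
rewrite laplacianD //.
have lp a : laplacian (P \o Q a) z <= - (al ^+ 2 * W (Q a z)).
  rewrite (laplacian_radial a z eps_gt0 (is_derive_profile al m_gt0)
    (is_derive_profile1 al m_gt0)).
  by have := profile_curvature al_gt0 al_le m_gt0 (sqdist_pos a z) (sqr_ge0 eps); lra.
have -> : laplacian (gauss_part \o Q 0) z = - (4 * del).
  have dg (q : R) : 0 < q -> is_derive q 1 gauss_part (- del).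
    have d := is_derive_affine (ln (2 * al * m) - P neck + del * eps ^+ 2) (- del) q.
    suff -> : gauss_part = fun t : R => ln (2 * al * m) - P neck + del * eps ^+ 2 + t * - del by [].
    by apply/funext => t; rewrite /gauss_part; ring.
  have dc (q : R) : 0 < q -> is_derive q 1 (fun=> - del) 0.
    by move=> _; exact: is_derive_cst.
  by rewrite (laplacian_radial 0 z eps_gt0 dg dc); ring.
by rewrite lerD2r lerD.
Qed.

Lemma neck_ge1 : 1 <= neck.
Proof. by rewrite /neck; have := rho_le1; have := rho_gt0; nra. Qed.

Lemma neck_le4 : neck <= 4.
Proof. by rewrite /neck; have := rho_le1; have := rho_gt0; nra. Qed.

Lemma neck_gt0 : 0 < neck.
Proof. exact: lt_le_trans neck_ge1. Qed.

Lemma expR_u0 z : expR (2 * u0 z) = al ^+ 2 * (W (Q 1 z) * W (Q (-1) z) / W neck)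
  * expR (- (2 * (del * (z.1 ^+ 2 + z.2 ^+ 2)))).
Proof.
rewrite u0E -(expR_profile al m_gt0 neck_gt0) -(expR_profile al m_gt0 (sqdist_pos 1 z))
  -(expR_profile al m_gt0 (sqdist_pos (-1) z)).
set p0 := P _; set p1 := P (Q 1 z); set p2 := P (Q (-1) z); set G := del * _.
have -> : 2 * (ln (2 * al * m) - p0 + p1 + p2 - G) =
   ln (2 * al * m) + ln (2 * al * m) - 2 * p0 + 2 * p1 + 2 * p2 + - (2 * G) by ring.
rewrite !expRD (expRN (2 * p0)) lnK; last by rewrite posrE !mulr_gt0.
have alg (A M e0 e1 e2 e : R) : M != 0 -> e0 != 0 ->
    2 * A * M * (2 * A * M) / e0 * e1 * e2 * e =
    A ^+ 2 * (4 * M ^+ 2 * e1 * (4 * M ^+ 2 * e2) / (4 * M ^+ 2 * e0)) * e.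
  by move=> M0 n0; field; rewrite M0 n0.
by apply: alg; rewrite gt_eqF ?expR_gt0.
Qed.

Lemma weight_le_mono p q : 0 < p -> p <= q -> W q <= W p.
Proof.
move=> p0 pq; have q0 := lt_le_trans p0 pq.
rewrite -(expR_profile al m_gt0 q0) -(expR_profile al m_gt0 p0) ler_pM2l.
  by rewrite ler_expR ler_wpM2l //; exact: profile_le.
by rewrite mulr_gt0 // exprn_gt0.
Qed.

(** From [1 <= neck <= 4] follows [1 <= neck^al <= 4], so the bound does not involve [al], which is
    chosen later. *)
Lemma weight_neck_ge : m ^+ 2 / (1 + 4 * m ^+ 2) ^+ 2 <= W neck.
Proof.
have n1 := neck_ge1; have n4 := neck_le4; have n0 := neck_gt0.
have m2 : 0 < m ^+ 2 by rewrite exprn_gt0.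
have L0 : 0 <= ln neck by rewrite ln_ge0.
have e1 : 1 <= expR (al * ln neck).
  by rewrite -expR0 ler_expR mulr_ge0 // ltW.
have e4 : expR (al * ln neck) <= 4.
  apply: le_trans n4; rewrite -ler_ln ?posrE ?expR_gt0 // expRK.
  by rewrite ler_piMl //; have := al_le; lra.
have p1 : m ^+ 2 <= pull al m neck by rewrite /pull ler_peMr // ltW.
have p4 : pull al m neck <= 4 * m ^+ 2 by rewrite /pull mulrC ler_wpM2r // ltW.
have pp : 0 < pull al m neck by exact: pull_gt0.
rewrite /weight ler_pdivlMr; last by rewrite mulr_gt0 // exprn_gt0 // addr_gt0.
rewrite mulrAC ler_pdivrMr; last by rewrite exprn_gt0 // addr_gt0 ?mulr_gt0.
have h : (1 + pull al m neck) ^+ 2 <= (1 + 4 * m ^+ 2) ^+ 2.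
  have a1 : 1 + pull al m neck <= 1 + 4 * m ^+ 2 by rewrite lerD2l.
  have a0 : 0 <= 1 + pull al m neck by rewrite addr_ge0 // ltW.
  by rewrite lerXn2r ?nnegrE // (le_trans a0).
have h2 : 0 <= (1 + pull al m neck) ^+ 2 by exact: sqr_ge0.
apply: (@le_trans _ _ (m ^+ 2 * (4 * (1 + 4 * m ^+ 2) ^+ 2))).
  by rewrite ler_wpM2l ?(ltW m2) // ler_pM // ltW.
by rewrite mulrA ler_wpM2r ?sqr_ge0 // mulrC ler_wpM2l.
Qed.

(* [a z.1 - 1] is, up to sign, the first coordinate of [z - (a, 0)]. *)
Lemma tip_coordinate a z : a ^+ 2 = 1 -> Q a z <= rho ^+ 2 ->
  [/\ 1 - rho <= a * z.1, a * z.1 <= 1 + rho, Q (- a) z = Q a z + 4 * (a * z.1)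
    & z.1 ^+ 2 + z.2 ^+ 2 <= Q a z + 2 * (a * z.1) - 1].
Proof.
rewrite /sqdist => a1 h.
have h1 : (a * z.1 - 1) ^+ 2 <= rho ^+ 2.
  (* The last term vanishes since [a ^+ 2 = 1]; this treats both tips at once. *)
  have -> : (a * z.1 - 1) ^+ 2 = (z.1 - a) ^+ 2 + (a ^+ 2 - 1) * (z.1 ^+ 2 - 1) by ring.
  rewrite a1 subrr mul0r addr0.
  by have := sqr_ge0 z.2; have := sqr_ge0 eps; lra.
have : `|a * z.1 - 1| <= rho.
  by rewrite -(@ler_pXn2r _ 2) ?nnegrE ?(ltW rho_gt0) // real_normK ?num_real.
rewrite ler_norml => /andP[ha hb]; split; [lra|lra| |].
  by ring.
have -> : (z.1 - a) ^+ 2 = z.1 ^+ 2 - 2 * (a * z.1) + a ^+ 2 by ring.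
by rewrite a1; have := sqr_ge0 eps; lra.
Qed.

Lemma neck_le_sqdist a z : a ^+ 2 = 1 -> Q a z <= rho ^+ 2 -> neck <= Q (- a) z.
Proof.
move=> a1 h; have [ha hb _ _] := tip_coordinate a1 h.
have -> : Q (- a) z = (a * z.1 + 1) ^+ 2 + (1 - a ^+ 2) * (z.1 ^+ 2 - 1) + z.2 ^+ 2 + eps ^+ 2.
  by rewrite /sqdist; ring.
rewrite a1 subrr mul0r addr0 -addrA ler_wpDr ?addr_ge0 ?sqr_ge0 //.
have := rho_le1 => r1; rewrite /neck lerXn2r ?nnegrE //; lra.
Qed.

(** The left side of the hypothesis is [al^2 rho^-4] divided by the lower bound for [W neck]: it
    dominates the exponential where both weights are at most [rho^-2]. *)
Lemma u0_curvature z :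
  al ^+ 2 * (1 + 4 * m ^+ 2) ^+ 2 / (m ^+ 2 * rho ^+ 4) <= 4 * del ->
  laplacian u0 z + expR (2 * u0 z) <= 0.
Proof.
move=> hdel.
have w0 : 0 < W neck by apply: weight_gt0 => //; exact: neck_gt0.
have wp a : 0 < W (Q a z) by apply: weight_gt0 => //; exact: sqdist_pos.
have a2 : 0 < al ^+ 2 by rewrite exprn_gt0.
have E : expR (2 * u0 z) <= al ^+ 2 * (W (Q 1 z) * W (Q (-1) z) / W neck).
  rewrite expR_u0 ler_piMr //.
    by apply/ltW; rewrite mulr_gt0 // divr_gt0 // mulr_gt0.
  rewrite -expR0 ler_expR oppr_le0 !mulr_ge0 ?addr_ge0 ?sqr_ge0 //.
  exact: ltW.
suff : al ^+ 2 * (W (Q 1 z) * W (Q (-1) z) / W neck) <=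
    al ^+ 2 * W (Q 1 z) + al ^+ 2 * W (Q (-1) z) + 4 * del.
  by have := laplacian_u0_le z; lra.
(* In the disc around a tip the other weight is at most [W neck], so the curvature of the nearby
   football alone pays for the product. *)
have tip a : a ^+ 2 = 1 -> Q a z <= rho ^+ 2 ->
    W (Q a z) * W (Q (- a) z) / W neck <= W (Q a z).
  move=> a1 h; rewrite ler_pdivrMr // ler_wpM2l ?(ltW (wp _)) //.
  by apply: weight_le_mono; [exact: neck_gt0|exact: neck_le_sqdist].
have d0 := del_gt0.
have t1 := ltW (mulr_gt0 a2 (wp 1)); have t2 := ltW (mulr_gt0 a2 (wp (-1))).
have [h1|h1] := leP (Q 1 z) (rho ^+ 2).
  have := tip 1 (expr1n _ _) h1; rewrite -(ler_pM2l a2); lra.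
have [h2|h2] := leP (Q (-1) z) (rho ^+ 2).
  have := tip (-1) _ h2; rewrite sqrrN expr1n opprK => /(_ erefl).
  rewrite [W (Q (-1) z) * _]mulrC -(ler_pM2l a2); lra.
suff : al ^+ 2 * (W (Q 1 z) * W (Q (-1) z) / W neck) <=
    al ^+ 2 * (1 + 4 * m ^+ 2) ^+ 2 / (m ^+ 2 * rho ^+ 4) by lra.
have r2 : 0 < rho ^+ 2 by rewrite exprn_gt0.
have m2 : 0 < m ^+ 2 by rewrite exprn_gt0.
have far a : rho ^+ 2 < Q a z -> W (Q a z) <= (rho ^+ 2)^-1.
  move=> h; apply: le_trans (weight_le _ m_gt0 (sqdist_pos a z)) _.
  by rewrite lef_pV2 ?posrE ?sqdist_pos // ltW.
rewrite -[leRHS]mulrA ler_wpM2l ?(ltW a2) // ler_pdivrMr //.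
have -> : (1 + 4 * m ^+ 2) ^+ 2 / (m ^+ 2 * rho ^+ 4) =
    (rho ^+ 2)^-1 * (rho ^+ 2)^-1 * (m ^+ 2 / (1 + 4 * m ^+ 2) ^+ 2)^-1.
  field; rewrite !gt_eqF //.
  by have := m2; lra.
apply: (@le_trans _ _ ((rho ^+ 2)^-1 * (rho ^+ 2)^-1)).
  by rewrite ler_pM ?(ltW (wp _)) ?far.
rewrite -[leRHS]mulrA ler_peMr ?mulr_ge0 ?invr_ge0 ?(ltW r2) //.
rewrite mulrC ler_pdivlMr ?mul1r; first exact: weight_neck_ge.
by rewrite divr_gt0 // exprn_gt0 // addr_gt0 // mulr_gt0.
Qed.

Lemma u0_decay : exists2 C, 0 < C & forall z,
  expR (u0 z) <= C * expR (- (Num.sqrt del ^+ 2 * (z.1 ^+ 2 + z.2 ^+ 2))).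
Proof.
(* The profile is decreasing and [Q a z >= eps ^+ 2], so both profiles are largest at [eps ^+ 2]. *)
exists (expR (ln (2 * al * m) - P neck + 2 * P (eps ^+ 2))); first exact: expR_gt0.
move=> z; rewrite sqr_sqrtr ?(ltW del_gt0) // -expRD ler_expR u0E lerD2r.
have h a : P (Q a z) <= P (eps ^+ 2).
  apply: profile_le => //; first by rewrite exprn_gt0.
  by rewrite /sqdist lerDr addr_ge0 ?sqr_ge0.
have := h 1; have := h (-1); lra.
Qed.

Lemma measurable_u0 : measurable_fun setT u0.
Proof.
have mQ a : measurable_fun setT (Q a).
  apply: measurable_funD => //; apply: measurable_funD; apply: measurable_funX.
    by apply: measurable_funB => //; exact: measurable_fst.
  exact: measurable_snd.
have mp : measurable_fun setT (pull al m).
  apply: measurable_funM => //; apply: measurableT_comp => //.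
  by apply: measurable_funM => //; exact: measurable_ln.
have mP : measurable_fun setT P.
  apply: measurable_funB.
    apply: measurableT_comp => //; apply: measurable_funM => //; exact: measurable_ln.
  by apply: measurableT_comp; [exact: measurable_ln|exact: measurable_funD].
have mg : measurable_fun setT gauss_part.
  by apply: measurable_funB => //; exact: measurable_funM.
apply: measurable_funD; last exact: measurableT_comp (mQ 0).
by apply: measurable_funD; exact: measurableT_comp (mQ _).
Qed.

End glued_footballs.

(** * The calibration and the distance between the tips *)

Section calibration.
Context {R : realType} (al m eps rho del a b k : R).
Hypotheses (al_gt0 : 0 < al) (al_le : al <= 1 / 2) (m_gt0 : 0 < m).
Hypotheses (eps_gt0 : 0 < eps) (rho_gt0 : 0 < rho) (rho_le1 : rho <= 1).
Hypotheses (del_gt0 : 0 < del) (b_lt_a : b < a).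
Hypothesis angle_far : a <= 2 * atan (m * rho).
Hypotheses (k_ge0 : 0 <= k) (k_le : k <= expR (- (4 * del)) * (neck rho / (2 + rho) ^+ 2)).
Implicit Types (z : R * R) (q t : R).
Local Notation Q := (sqdist eps).
Local Notation W := (weight al m).
Local Notation u0 := (u0 al m eps rho del).

Definition calib q : R := cutoff a b (angle al m q).
Definition calib1 q : R := cutoff1 a b (angle al m q) * angle1 al m q.

Lemma is_derive_calib q : 0 < q -> is_derive q 1 calib (calib1 q).
Proof.
move=> q0.
exact: (@is_derive1_comp _ (cutoff a b) _ q _ _ (is_derive_cutoff _ b_lt_a)
  (is_derive_angle al m_gt0 q0)).
Qed.

(** Since [rho <= 1] and [al <= 1], [q^(al/2) >= rho^al >= rho]. This is why [angle_far] can be free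
    of [al]. *)
Lemma angle_ge q : rho ^+ 2 <= q -> a <= angle al m q.
Proof.
move=> rq; apply: le_trans angle_far _; rewrite /angle ler_pM2l //; apply: le_atan; rewrite ler_pM2l //.
have r2 : 0 < rho ^+ 2 by rewrite exprn_gt0.
rewrite -ler_ln ?posrE ?expR_gt0 // expRK.
have l1 : ln rho <= 0 by rewrite ln_le0.
have l2 : ln rho * 2 <= ln q.
  by rewrite mulr_natr -lnXn // ler_ln ?posrE // (lt_le_trans r2).
have := al_le; have := al_gt0 => a0 a1.
have [q1|q1] := leP 0 (ln q); last by nra.
by apply: le_trans l1 _; rewrite mulr_ge0 // divr_ge0 // ltW.
Qed.

Lemma calib1_eq0 q : rho ^+ 2 <= q -> calib1 q = 0.
Proof. by move=> /angle_ge h; rewrite /calib1 cutoff1_eq0 // mul0r. Qed.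

Lemma calib_eq0 q : rho ^+ 2 <= q -> calib q = 0.
Proof. by move=> /angle_ge h; rewrite /calib cutoff_eq0. Qed.

(** For [r2] the true squared distance to the tip, the left side is the squared gradient of [calib]
    composed with [Q]; the cutoff has slope in [[0, 1]]. *)
Lemma calib1_le q r2 : 0 < q -> 0 <= r2 -> r2 <= q ->
  4 * r2 * calib1 q ^+ 2 <= al ^+ 2 * W q.
Proof.
move=> q0 r0 rq; apply: le_trans (angle1_le al m_gt0 q0 rq).
rewrite ler_wpM2l ?mulr_ge0 // /calib1 exprMn ler_piMl ?sqr_ge0 //.
by rewrite expr_le1 ?cutoff1_le1 ?cutoff1_ge0.
Qed.

Lemma continuous_calib1 q : 0 < q -> {for q, continuous calib1}.
Proof.
move=> q0.
have cL : {for q, continuous (@ln R)} by exact: continuous_ln.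
have cE c : {for q, continuous (fun x => expR (c * ln x))}.
  have cl : {for q, continuous (fun x => c * ln x)} by apply: cvgM; [exact: cvg_cst|exact: cL].
  exact: (continuous_comp cl (@continuous_expR R _)).
have ca : {for q, continuous (angle al m)}.
  have [d _] := is_derive_angle al m_gt0 q0.
  exact/differentiable_continuous/derivable1_diffP.
have cc : {for q, continuous (cutoff1 a b \o angle al m)}.
  by apply: continuous_comp => //; exact: continuous_cutoff1.
have cp : {for q, continuous (pull al m)} by apply: cvgM; [exact: cvg_cst|exact: cE].
apply: (cvgM cc); apply: cvgM.
  by apply: cvgM; [exact: cvg_cst|apply: cvgM; [exact: cvg_cst|exact: cE]].
apply: cvgV; first by rewrite mulf_neq0 ?pull1_neq0 // gt_eqF.
by apply: cvgM; [exact: cvg_id|apply: cvgD; [exact: cvg_cst|exact: cp]].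
Qed.

Definition phi z : R := k * (calib (Q 1 z) - calib (Q (-1) z)).
Definition phi_x z : R :=
  k * (calib1 (Q 1 z) * (2 * (z.1 - 1)) - calib1 (Q (-1) z) * (2 * (z.1 + 1))).
Definition phi_y z : R :=
  k * (calib1 (Q 1 z) * (2 * z.2) - calib1 (Q (-1) z) * (2 * z.2)).

Let Q_gt0 c z : 0 < Q c z. Proof. exact: sqdist_gt0. Qed.

Lemma continuous_calib1_sqdist c : continuous (calib1 \o Q c).
Proof.
move=> z; apply: continuous_comp; first exact: (smooth_sqdist eps c 0%N).
exact: continuous_calib1.
Qed.

Lemma continuous_phi_x : continuous phi_x.
Proof.
have cf c : continuous (fun z : R * R => 2 * (z.1 + c)).
  by move=> z; apply: cvgM; [exact: cvg_cst|apply: cvgD; [exact: cvg_fst|exact: cvg_cst]].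
move=> z; apply: cvgM; first exact: cvg_cst.
apply: cvgB; apply: cvgM.
- exact: continuous_calib1_sqdist.
- exact: (cf (-1)).
- exact: continuous_calib1_sqdist.
- exact: cf.
Qed.

Lemma continuous_phi_y : continuous phi_y.
Proof.
have cf : continuous (fun z : R * R => 2 * z.2).
  by move=> z; apply: cvgM; [exact: cvg_cst|exact: cvg_snd].
move=> z; apply: cvgM; first exact: cvg_cst.
by apply: cvgB; apply: cvgM; first [exact: continuous_calib1_sqdist | exact: cf].
Qed.

Lemma gradient_phi : gradient_along_curves phi phi_x phi_y.
Proof.
move=> g t d1 d2 D1 D2.
have dQ c : is_derive t 1 (fun s => Q c (g s)) (2 * ((g t).1 - c) * d1 + 2 * (g t).2 * d2).
  have dc (x : R) : is_derive t 1 (fun=> x) 0 by exact: is_derive_cst.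
  have e1 := is_deriveB D1 (dc c).
  have e := is_deriveD (is_deriveD (is_deriveM e1 e1) (is_deriveM D2 D2)) (dc (eps ^+ 2)).
  have -> : (fun s => Q c (g s)) = ((fun s => (g s).1) - (fun=> c)) * ((fun s => (g s).1) - (fun=> c))
    + (fun s => (g s).2) * (fun s => (g s).2) + (fun=> eps ^+ 2).
    by apply/funext => s; rewrite /sqdist !expr2.
  by apply: is_derive_eq e _; rewrite /GRing.scale /= !fctE; ring.
have dc c : is_derive t 1 (fun s => calib (Q c (g s)))
    (calib1 (Q c (g t)) * (2 * ((g t).1 - c) * d1 + 2 * (g t).2 * d2)).
  exact: (@is_derive1_comp _ calib _ t _ _ (is_derive_calib (Q_gt0 c (g t))) (dQ c)).
apply: is_derive_eq (@is_deriveZ _ _ _ _ k t 1 _ (is_deriveB (dc 1) (dc (-1)))) _.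
rewrite /GRing.scale /= /phi_x /phi_y; ring.
Qed.

(** In squared form: near a tip the glued metric is at least [k] times the football there. The
    squared distance to the far tip is at most [(2 + rho)^2], and [|z|^2 <= (1 + rho)^2 <= 4]
    explains the [4 * del] in [k_le]. *)
Lemma near_tip_weight c z : c ^+ 2 = 1 -> Q c z <= rho ^+ 2 ->
  k ^+ 2 * W (neck rho) <= W (Q (- c) z) * expR (- (2 * (del * (z.1 ^+ 2 + z.2 ^+ 2)))).
Proof.
move=> c1 h; have [h1 h2 h3 h4] := tip_coordinate rho_gt0 c1 h.
have n0 : 0 < neck rho := neck_gt0 rho_gt0 rho_le1.
have nQ : neck rho <= Q (- c) z := neck_le_sqdist rho_gt0 rho_le1 c1 h.
have Qle : Q (- c) z <= (2 + rho) ^+ 2.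
  have -> : (2 + rho) ^+ 2 = rho ^+ 2 + 4 * (1 + rho) by ring.
  by rewrite h3; lra.
have zle : z.1 ^+ 2 + z.2 ^+ 2 <= 4.
  have r1 : rho ^+ 2 <= 1 by rewrite expr_le1 ?(ltW rho_gt0).
  by have := rho_le1; lra.
have d0 := del_gt0.
rewrite -(expR_profile al m_gt0 (Q_gt0 (- c) z)) -(expR_profile al m_gt0 n0).
have pd := profile_ge al_gt0 al_le m_gt0 n0 nQ.
have lQ : ln (Q (- c) z) <= ln ((2 + rho) ^+ 2).
  by rewrite ler_ln ?posrE // (lt_le_trans (Q_gt0 (- c) z)).
have r20 : 0 < (2 + rho) ^+ 2 by exact: lt_le_trans Qle.
have k2 : k ^+ 2 <= expR (2 * (- (4 * del) + ln (neck rho) - ln ((2 + rho) ^+ 2))).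
  rewrite expRM_natl lerXn2r ?nnegrE ?expR_ge0 //; apply: le_trans k_le _.
  by rewrite !expRD (expRN (ln ((2 + rho) ^+ 2))) !lnK ?posrE // -mulrA.
rewrite mulrCA -mulrA ler_pM2l; last by rewrite mulr_gt0 // exprn_gt0.
apply: (@le_trans _ _ (expR (2 * (- (4 * del) + ln (neck rho) - ln ((2 + rho) ^+ 2)))
    * expR (2 * profile al m (neck rho)))).
  by rewrite ler_wpM2r ?expR_ge0.
rewrite -!expRD ler_expR.
have : del * (z.1 ^+ 2 + z.2 ^+ 2) <= del * 4 by rewrite ler_wpM2l ?(ltW d0).
move: pd lQ; set x := ln (Q _ _); set y := profile _ _ (Q _ _); set x' := ln (neck _).
set y' := profile _ _ _; set G := del * _; set l := ln (_ ^+ 2).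
lra.
Qed.

(** Because [rho ^+ 2 <= neck], at most one of the two cut-off angles has nonzero gradient at a
    given point, and there [near_tip_weight] applies. *)
Lemma phi_bound z : phi_x z ^+ 2 + phi_y z ^+ 2 <= expR (u0 z) ^+ 2.
Proof.
rewrite -expRM_natl expR_u0 //.
have n0 : 0 < neck rho := neck_gt0 rho_gt0 rho_le1.
have w0 : 0 < W (neck rho) by exact: weight_gt0.
have wp c : 0 < W (Q c z) by exact: weight_gt0.
have rho2_neck : rho ^+ 2 <= neck rho.
  by have := rho_le1; have := rho_gt0; rewrite /neck; nra.
have tip c : c ^+ 2 = 1 -> Q c z <= rho ^+ 2 ->
    k ^+ 2 * (4 * ((z.1 - c) ^+ 2 + z.2 ^+ 2) * calib1 (Q c z) ^+ 2) <=
    al ^+ 2 * (W (Q c z) * W (Q (- c) z) / W (neck rho)) *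
    expR (- (2 * (del * (z.1 ^+ 2 + z.2 ^+ 2)))).
  move=> c1 h; have kw := near_tip_weight c1 h.
  apply: (@le_trans _ _ (k ^+ 2 * (al ^+ 2 * W (Q c z)))).
    rewrite ler_wpM2l ?sqr_ge0 // calib1_le ?addr_ge0 ?sqr_ge0 //.
    by rewrite /sqdist lerDl sqr_ge0.
  have alg (x y v w e : R) : x * (y * v / w) * e = x * y * (v * e) / w.
    by rewrite !mulrA mulrAC.
  rewrite alg ler_pdivlMr //.
  have alg2 (x y v w : R) : x * (y * v) * w = y * v * (x * w) by ring.
  by rewrite alg2 ler_wpM2l // ltW // mulr_gt0 // exprn_gt0.
have [h1|h1] := leP (Q 1 z) (rho ^+ 2).
  have z2 : calib1 (Q (-1) z) = 0.
    by rewrite calib1_eq0 // (le_trans rho2_neck) // neck_le_sqdist // expr1n.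
  apply: le_trans (tip 1 (expr1n _ _) h1).
  by rewrite /phi_x /phi_y z2; rewrite le_eqVlt; apply/orP; left; apply/eqP; ring.
have z1 : calib1 (Q 1 z) = 0 by rewrite calib1_eq0 // ltW.
have [h2|h2] := leP (Q (-1) z) (rho ^+ 2).
  have := tip (-1) _ h2; rewrite sqrrN expr1n opprK => /(_ erefl) H.
  rewrite [W (Q 1 z) * _]mulrC; apply: le_trans H.
  by rewrite /phi_x /phi_y z1; rewrite le_eqVlt; apply/orP; left; apply/eqP; ring.
have z2 : calib1 (Q (-1) z) = 0 by rewrite calib1_eq0 // ltW.
rewrite /phi_x /phi_y z1 z2 !mul0r subrr mulr0 expr0n addr0.
apply/ltW; rewrite mulr_gt0 ?expR_gt0 // mulr_gt0 ?exprn_gt0 // divr_gt0 //.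
by rewrite mulr_gt0.
Qed.

Lemma diam_u0_ge (e : R) : eps <= rho -> angle al m (eps ^+ 2) <= e -> e <= b ->
  ((2 * k * ((a + b) / 2 - e))%:E <= conformal_diam u0)%E.
Proof.
move=> er ae eb.
apply: (@le_trans _ _ (conformal_dist u0 (1, 0) (-1, 0))); last first.
  by apply: ereal_sup_ubound; exists ((1, 0), (-1, 0)).
apply: le_ereal_inf_tmp => _ [c [Cc c0 c1] <-].
have cu : continuous u0 by apply: (@Ck_continuous _ 0%N); exact: smooth_u0.
apply: le_trans (conformal_length_ge cu continuous_phi_x continuous_phi_y gradient_phi
  phi_bound Cc).
rewrite c0 c1 lee_fin /phi.
(* At each tip the [calib] of the other one is 0, so each end of the curve contributes
   [k * ((a + b) / 2 - angle)]. *)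
have -> : Q 1 (-1, 0) = 4 + eps ^+ 2 by rewrite /sqdist /=; ring.
have -> : Q (-1) (-1, 0) = eps ^+ 2 by rewrite /sqdist /=; ring.
have -> : Q 1 (1, 0) = eps ^+ 2 by rewrite /sqdist /=; ring.
have -> : Q (-1) (1, 0) = 4 + eps ^+ 2 by rewrite /sqdist /=; ring.
rewrite (@calib_eq0 (4 + eps ^+ 2)); last first.
  by have := rho_le1; have := rho_gt0; have := sqr_ge0 eps; nra.
rewrite /calib (cutoff_below b_lt_a (le_trans ae eb)).
have : k * angle al m (eps ^+ 2) <= k * e by rewrite ler_wpM2l.
by set A := angle _ _ _; lra.
Qed.

End calibration.

(** * Choice of the constants and conclusion *)

Section parameters.
Context {R : realType}.
Implicit Types (d eta m al C : R) (u : R * R -> R).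

Lemma laplacian_shift u (c : R) z : smooth u ->
  laplacian (fun z => u z + c) z = laplacian u z.
Proof.
move=> su; have sc : smooth (fun=> c : R) by move=> k; exact: Ck_cst.
have -> : (fun z => u z + c) = u + (fun=> c) by [].
rewrite laplacianD //.
have E (v : R * R) (e : R) : (fun w => 'D_v (fun=> e : R) w) = fun=> 0.
  by apply/funext => w; exact: derive_cst.
by rewrite {2}/laplacian /partial_x /partial_y !E !derive_cst !addr0.
Qed.

Lemma tan_gt0_of_pihalf (x : R) : 0 < x -> x < pi / 2 -> 0 < tan x.
Proof.
move=> x0 xp; rewrite ltNge; apply/negP => /le_atan.
rewrite atan0 tanK; last by rewrite in_itv /=; apply/andP; split => //; have := @pi_gt0 R; lra.
by rewrite leNgt x0.
Qed.

Lemma wide_sphere_plane d : 0 < d -> d < 2 * pi -> exists u : R * R -> R,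
  [/\ smooth u /\ measurable_fun setT u,
      forall z, laplacian u z + expR (2 * u z) <= 0,
      exists C s, [/\ 0 < C, 0 < s & forall z : R * R,
        expR (u z) <= C * expR (- (s ^+ 2 * (z.1 ^+ 2 + z.2 ^+ 2)))]
    & (d%:E <= conformal_diam u)%E].
Proof.
move=> d0 dpi.
have pi4 : pi <= 4 :> R.
  by have := @pihalf_lt2 R; lra.
(* The calibration gives at least [2 (1 - 2 eta) (pi - 5 eta / 2)], which exceeds [2 pi - 21 eta] as
   [pi <= 4]; the 11 makes [d = 2 pi - 22 eta]. *)
pose eta : R := (pi - d / 2) / 11.
have eta0 : 0 < eta by rewrite /eta; lra.
have eta4 : eta <= 4 / 11 by rewrite /eta; lra.
have etapi : 11 * eta < pi by rewrite /eta; lra.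
have etad : d = 2 * pi - 22 * eta by rewrite /eta; lra.
clearbody eta.
pose rho := eta / 3; pose del := eta / 4; pose a := pi - eta; pose b := pi - 2 * eta.
pose k := 1 - 2 * eta.
have rho0 : 0 < rho by rewrite /rho; lra.
have rho1 : rho <= 1 by rewrite /rho; lra.
have del0 : 0 < del by rewrite /del; lra.
have ab : b < a by rewrite /a /b; lra.
have k0 : 0 <= k by rewrite /k; lra.
have ta : 0 < tan (a / 2) by apply: tan_gt0_of_pihalf; rewrite /a; lra.
have te : 0 < tan (eta / 2) by apply: tan_gt0_of_pihalf; lra.
pose m := tan (a / 2) / rho.
have m0 : 0 < m by rewrite divr_gt0.
have far : a <= 2 * atan (m * rho).
  rewrite /m divfK ?gt_eqF // tanK ?in_itv /=; first by rewrite /a; lra.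
  by apply/andP; split; rewrite /a; lra.
pose K := (1 + 4 * m ^+ 2) ^+ 2 / (m ^+ 2 * rho ^+ 4).
have m2 : 0 < m ^+ 2 by rewrite exprn_gt0.
have K0 : 0 < K.
  have c0 : 0 < 1 + 4 * m ^+ 2 by lra.
  by rewrite /K divr_gt0 // ?exprn_gt0 // mulr_gt0 // exprn_gt0.
pose al := Num.min (1 / 2) (eta / K).
have al0 : 0 < al by rewrite lt_min; apply/andP; split; [lra|exact: divr_gt0].
have al1 : al <= 1 / 2 by rewrite ge_min lexx.
have alK : al * K <= eta by rewrite -ler_pdivlMr // ge_min lexx orbT.
(* The second entry solves [m eps^al = tan (eta / 2)], that is, it puts the smoothed tip at angle
   [eta]. *)
pose eps := Num.min rho (expR (ln (tan (eta / 2) / m) / al)).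
have eps0 : 0 < eps by rewrite lt_min rho0 expR_gt0.
have epsr : eps <= rho by rewrite ge_min lexx.
have curv : al ^+ 2 * (1 + 4 * m ^+ 2) ^+ 2 / (m ^+ 2 * rho ^+ 4) <= 4 * del.
  rewrite -mulrA -/K expr2 -mulrA; apply: (@le_trans _ _ (1 * (al * K))).
    by apply: ler_wpM2r; [rewrite mulr_ge0 // ltW|apply: le_trans al1 _; lra].
  by rewrite mul1r /del; lra.
(* The choices [4 del = eta] and [3 rho = eta] make each factor at least [1 - eta], and
   [(1 - eta)^2 >= k]. *)
have kle : k <= expR (- (4 * del)) * (neck rho / (2 + rho) ^+ 2).
  have e1 : 1 - eta <= expR (- (4 * del)).
    by apply: le_trans (expR_ge1Dx _); rewrite /del; lra.
  have e2 : 1 - eta <= neck rho / (2 + rho) ^+ 2.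
    rewrite ler_pdivlMr; last by rewrite exprn_gt0 // addr_gt0.
    have -> : eta = 3 * rho by rewrite /rho; lra.
    have := mulr_gt0 rho0 rho0; have := mulr_gt0 (mulr_gt0 rho0 rho0) rho0.
    by rewrite /neck; lra.
  apply: (@le_trans _ _ ((1 - eta) * (1 - eta))).
    by rewrite /k; have := mulr_gt0 eta0 eta0; lra.
  by rewrite ler_pM //; lra.
have near : angle al m (eps ^+ 2) <= eta.
  have t0 : 0 < tan (eta / 2) / m by exact: divr_gt0.
  have le : ln eps * al <= ln (tan (eta / 2) / m).
    by rewrite -ler_pdivlMr // -ler_expR lnK ?posrE // ge_min lexx orbT.
  have -> : eta = 2 * atan (tan (eta / 2)).
    by rewrite tanK ?in_itv /=; [lra|apply/andP; split; lra].
  rewrite /angle ler_pM2l //; apply: le_atan.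
  rewrite mulrC -ler_pdivlMr // -[leRHS]lnK ?posrE // ler_expR.
  apply: le_trans le; rewrite lnXn // [leLHS](_ : _ = ln eps * al) //.
  by set x := ln eps; clearbody al x; field.
exists (u0 al m eps rho del); split.
- split; first exact: smooth_u0.
  exact: measurable_u0.
- by move=> z; apply: u0_curvature.
- have [C C0 hC] := u0_decay rho al0 al1 m0 eps0 del0.
  by exists C, (Num.sqrt del); split => //; rewrite sqrtr_gt0.
- apply: le_trans (diam_u0_ge al0 al1 m0 eps0 rho0 rho1 del0 ab far k0 kle epsr near _).
    rewrite lee_fin etad /a /b /k.
    have : pi * eta <= 4 * eta by rewrite ler_wpM2r // ltW.
    by have := mulr_gt0 eta0 eta0; lra.
  by rewrite /b; lra.
Qed.

End parameters.

Theorem proposition1p1 (R : realType) (d : R) (d_gt0 : 0 < d)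
    (d_lt : d < 2 * pi) :
  exists u : R * R -> R,
    [/\ smooth u,
        forall z : R * R, laplacian u z + expR (2 * u z) <= 0,
        (conformal_area u < +oo)%E
      & conformal_diam u = d%:E].
Proof.
have [v [[sv mv] Kv [C [s [C0 s0 decay]]] dv]] := wide_sphere_plane d_gt0 d_lt.
have cv : continuous v := sv 0%N.
have fin : conformal_diam v \is a fin_num.
  rewrite ge0_fin_numE; first exact: conformal_diam_lty decay.
  by apply: le_trans dv; rewrite lee_fin ltW.
pose D := fine (conformal_diam v).
have vD : conformal_diam v = D%:E by rewrite fineK.
have dD : d <= D by rewrite -lee_fin -vD.
have D0 : 0 < D := lt_le_trans d_gt0 dD.
pose c := ln (d / D).
have ec : expR c = d / D by rewrite lnK // posrE divr_gt0.
exists (fun z => v z + c); split.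
- by move=> k; apply: (@CkD _ k v (fun=> c)); [exact: sv|exact: Ck_cst].
(* As [d <= D], the constant [c] is at most 0: the shift keeps the Laplacian and does not increase
   the exponential. *)
- move=> z; rewrite laplacian_shift //; apply: le_trans (Kv z).
  rewrite lerD2l ler_expR mulrDr gerDl pmulr_rle0 // ln_le0 //.
  by rewrite ler_pdivrMr // mul1r.
- apply: (@conformal_area_lty _ _ (C * expR c) s) => //.
  + exact: measurable_funD.
  + by rewrite mulr_gt0 // expR_gt0.
  + by move=> z; rewrite expRD mulrAC ler_wpM2r // expR_ge0.
- by rewrite conformal_diam_shift // vD ec -EFinM divfK // gt_eqF.
Qed.
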